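(* Let $N\ge 1$, let $Q,B$ be real $N\times N$ matrices with $Q=Q^\star\ge 0$ such that $K(t)$ is invertible for every $t>0$. Let $\operatorname{tr}B=0$, and consider $f\in\bigcup_{0<s<1}\mathfrak B^{\mathscr A}_{s,1}$ such that $f\ge0$. Then $$\lim_{s\to0^+}\|(-\mathscr A)^sf\|_1=2\|f\|_1.$$
   Context: Here $Q,B$ are the constant coefficients of the operator $\mathscr A u=\operatorname{tr}(Q\nabla^2u)+\langle BX,\nabla u\rangle$ on $\mathbb R^N$, and $K(t)=\frac1t\int_0^t e^{sB}Qe^{sB^\star}\,ds$ for $t>0$ ($^\star$ denotes transpose). $\|\cdot\|_1$ is the norm of $L^1=L^1(\mathbb R^N)$. For $X,Y\in\mathbb R^N$, $t>0$, $$p(X,Y,t)=\frac{(4\pi)^{-N/2}}{\sqrt{\det(tK(t))}}\exp\Big(-\frac{\langle K(t)^{-1}(Y-e^{tB}X),\,Y-e^{tB}X\rangle}{4t}\Big),\qquad P_tf(X)=\int_{\mathbb R^N}p(X,Y,t)f(Y)\,dY.$$ For $s>0$, $$\mathscr N^{\mathscr A}_{s,1}(f)=\int_0^\infty \frac{1}{t^{\frac{s}{2}+1}}\int_{\mathbb R^N}\int_{\mathbb R^N}p(X,Y,t)|f(Y)-f(X)|\,dY\,dX\,dt,$$ and $\mathfrak B^{\mathscr A}_{s,1}$ is the set of $f\in L^1$ with $\mathscr N^{\mathscr A}_{s,1}(f)<\infty$. The fractional powers are $$(-\mathscr A)^sf=-\frac{s}{\Gamma(1-s)}\int_0^\infty\frac{1}{t^{1+s}}\big(P_tf-f\big)\,dt,\qquad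 0<s<1.$$ If $\operatorname{tr}B\ge0$ and $f\in\mathfrak B^{\mathscr A}_{\sigma,1}$ for some $\sigma\in(0,1)$, then for every $0<s\le\sigma/2$ this integral converges absolutely as an $L^1$-valued integral, so $(-\mathscr A)^sf\in L^1$ is well defined for all sufficiently small $s>0$. *)

(* Defs.v *)
From HB Require Import structures.
From mathcomp Require Import all_boot all_order all_algebra.
From mathcomp Require Import all_classical all_reals all_analysis.
From mathcomp Require Import measurable_realfun.

Set Implicit Arguments.
Unset Strict Implicit.
Unset Printing Implicit Defensive.

Import Order.TTheory GRing.Theory Num.Theory.
Import numFieldNormedType.Exports.

Local Open Scope classical_set_scope.
Local Open Scope ring_scope.

(* Points of $\mathbb R^n$ are tuples, because it is [n.-tuple T], and not
   ['cV[T]_n], that carries the product sigma-algebra; [colvec] is the passage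
   to linear algebra. *)
Notation "''R[' R ]^ n" := (n.-tuple (measurableTypeR R))
  (at level 8, n at level 2, format "''R[' R ]^ n") : type_scope.

Definition colvec (R : realType) (n : nat) (x : 'R[R]^n) : 'cV[R]_n :=
  \col_i tnth x i.

Section lebesgue_measure_tuple.
Context (R : realType).

Definition tuple_cons (n : nat) (z : measurableTypeR R * 'R[R]^n) :
  'R[R]^n.+1 := [tuple of z.1 :: z.2].

Lemma measurable_tuple_cons (n : nat) :
  measurable_fun [set: measurableTypeR R * 'R[R]^n] (@tuple_cons n).
Proof. by apply: measurable_cons; [exact: measurable_fst|exact: measurable_snd]. Qed.

Definition lebesgue_cons (n : nat)
    (m : {sigma_finite_measure set 'R[R]^n -> \bar R}) :
    set 'R[R]^n.+1 -> \bar R :=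
  pushforward (lebesgue_measure \x m)%E (@tuple_cons n).


Section lebesgue_cons_measure.
Context (n : nat) (m : {sigma_finite_measure set 'R[R]^n -> \bar R}).

Let mpreimage (A : set 'R[R]^n.+1) :
  measurable A -> measurable (@tuple_cons n @^-1` A).
Proof. by move=> mA; rewrite -[X in measurable X]setTI; exact: measurable_tuple_cons. Qed.

Let lebesgue_cons0 : lebesgue_cons m set0 = 0%E.
Proof. by rewrite /lebesgue_cons /pushforward preimage_set0 measure0. Qed.

Let lebesgue_cons_ge0 A : (0 <= lebesgue_cons m A)%E.
Proof. by rewrite /lebesgue_cons /pushforward; exact: measure_ge0. Qed.

Let lebesgue_cons_sigma_additive : semi_sigma_additive (lebesgue_cons m).
Proof.
move=> F mF tF mUF; rewrite /lebesgue_cons /pushforward preimage_bigcup.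
apply: measure_semi_sigma_additive.
- by move=> k; exact: mpreimage.
- apply/trivIsetP => /= i j _ _ ij; rewrite -preimage_setI.
  by move/trivIsetP : tF => /(_ _ _ _ _ ij) ->//; rewrite preimage_set0.
- by rewrite -preimage_bigcup; exact: mpreimage.
Qed.

HB.instance Definition _ := isMeasure.Build _ _ _ (lebesgue_cons m)
  lebesgue_cons0 lebesgue_cons_ge0 lebesgue_cons_sigma_additive.

Let lebesgue_cons_sigma_finite : sigma_finite [set: 'R[R]^n.+1] (lebesgue_cons m).
Proof.
have /sigma_finiteP[F [FT ndF Foo]] := sigma_finiteT (@lebesgue_measure R).
have /sigma_finiteP[G [GT ndG Goo]] := sigma_finiteT m.
have mbehead : measurable_fun setT (fun x : 'R[R]^n.+1 => [tuple of behead x]).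
  exact: measurable_behead.
have mthead : measurable_fun setT (fun x : 'R[R]^n.+1 => thead x).
  exact: measurable_tnth.
exists (fun k => (@thead n _ @^-1` F k) `&`
    ((fun x : 'R[R]^n.+1 => [tuple of behead x]) @^-1` G k)).
  rewrite predeqE => x; split => // _.
  have [i _ Fi] : (\bigcup_k F k) (thead x) by rewrite -FT.
  have [j _ Gj] : (\bigcup_k G k) [tuple of behead x] by rewrite -GT.
  exists (maxn i j) => //; split => /=.
  - by move: Fi; apply/subsetPset/ndF/leq_maxl.
  - by move: Gj; apply/subsetPset/ndG/leq_maxr.
move=> k; have [mF Fk] := Foo k; have [mG Gk] := Goo k; split.
  apply: measurableI; rewrite -[X in measurable X]setTI; first exact: mthead.
  exact: mbehead.
rewrite /lebesgue_cons /pushforward (_ : _ @^-1` _ = F k `*` G k).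
  by rewrite product_measure1E// lte_mul_pinfty// ge0_fin_numE.
apply/seteqP; split=> -[a x] /=; rewrite /tuple_cons theadE /= (_ : [tuple of _] = x)//;
  exact/val_inj.
Qed.

HB.instance Definition _ := Measure_isSigmaFinite.Build _ _ _ (lebesgue_cons m)
  lebesgue_cons_sigma_finite.

End lebesgue_cons_measure.

(* Lebesgue measure on the Borel sets of $\mathbb R^n$, as an iterated product. *)
Fixpoint lebesgue_tuple (n : nat) :
    {sigma_finite_measure set 'R[R]^n -> \bar R} :=
  match n with
  | 0 => \d_([tuple] : 'R[R]^0)
  | n'.+1 => lebesgue_cons (lebesgue_tuple n')
  end.

End lebesgue_measure_tuple.

(* Bochner integral of an [L^1(mu)]-valued function over [D], elements of
   [L^1(mu)] being given by representatives: the limit of the integrals of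
   step functions [S k] with [\int_D ||F - S k||_1 -> 0]. The measurability of
   [u |-> ||F u - S k u||_1] makes that an ordinary Lebesgue integral, and [F]
   strongly measurable. *)
Section L1_valued_integral.
Context d d' (U : measurableType d) (T : measurableType d') (R : realType).
Variables (nu : {measure set U -> \bar R}) (mu : {measure set T -> \bar R}).

Record L1_step := L1Step {
  step_size : nat;
  step_set : 'I_step_size -> set U;
  step_val : 'I_step_size -> T -> R;
  measurable_step_set : forall i, measurable (step_set i);
  step_set_lty : forall i, (nu (step_set i) < +oo)%E;
  step_val_Lfun : forall i, step_val i \in Lfun mu 1 }.

Definition step_fun (S : L1_step) (u : U) (x : T) : R :=
  \sum_(i < step_size S) \1_(step_set i) u * @step_val S i x.

Definition step_integral (D : set U) (S : L1_step) (x : T) : R :=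
  \sum_(i < step_size S) fine (nu (D `&` step_set i)) * @step_val S i x.

Definition L1_dist (f g : T -> R) : \bar R :=
  ('N[mu]_1 [EFin \o (f \- g)%R])%E.

Definition is_L1_integral (D : set U) (F : U -> T -> R) (g : T -> R) : Prop :=
  [/\ forall u, D u -> F u \in Lfun mu 1,
      g \in Lfun mu 1 &
      exists S : L1_step^nat,
        [/\ forall k, measurable_fun D (fun u => L1_dist (F u) (step_fun (S k) u)),
            (\int[nu]_(u in D) L1_dist (F u) (step_fun (S k) u))%E
              @[k --> \oo] --> 0%E &
            L1_dist (step_integral D (S k)) g @[k --> \oo] --> 0%E]].

(* A representative of the integral; the zero function if [F] is not
   Bochner integrable. *)
Definition L1_integral (D : set U) (F : U -> T -> R) : T -> R :=
  xget (cst 0) [set g | is_L1_integral D F g].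

End L1_valued_integral.

Definition Gamma (R : realType) (z : R) : R :=
  (\int[lebesgue_measure]_(t in `]0, +oo[) (t `^ (z - 1) * expR (- t)))%R.

Definition expmx (R : realType) (n : nat) (A : 'M[R]_n) : 'M[R]_n :=
  limn (series (fun k => (k`!%:R : R)^-1 *: A ^+ k)).

Definition dotmx (R : realType) (n : nat) (v w : 'cV[R]_n) : R :=
  (v^T *m w) 0 0.

Definition psdmx (R : realType) (n : nat) (A : 'M[R]_n) : Prop :=
  A^T = A /\ forall v : 'cV[R]_n, 0 <= dotmx (A *m v) v.

Section kolmogorov_operator.
Context (R : realType) (N : nat) (Q B : 'M[R]_N).

Let leb := @lebesgue_tuple R N.

Definition Kmx (t : R) : 'M[R]_N :=
  t^-1 *: \matrix_(i, j) (\int[lebesgue_measure]_(s in `[0%R, t])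
    (expmx (s *: B) *m Q *m expmx (s *: B^T)) i j)%R.

Definition kernel_p (X Y : 'R[R]^N) (t : R) : R :=
  let v := colvec Y - expmx (t *: B) *m colvec X in
  (4 * pi) `^ (- (N%:R / 2)) / Num.sqrt (\det (t *: Kmx t)) *
  expR (- (dotmx (invmx (Kmx t) *m v) v / (4 * t))).

Definition semigroup (t : R) (f : 'R[R]^N -> R) (X : 'R[R]^N) : R :=
  (\int[leb]_Y (kernel_p X Y t * f Y))%R.

(* Both [besov_seminorm] and [besov] depend only on the a.e. class of [f]. *)
Definition besov_seminorm (s : R) (f : 'R[R]^N -> R) : \bar R :=
  (\int[lebesgue_measure]_(t in `]0%R, +oo[)
     (((t `^ (s / 2 + 1))^-1)%:E *
      \int[leb]_X \int[leb]_Y (kernel_p X Y t * `|f Y - f X|)%:E))%E.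

Definition besov (s : R) : set ('R[R]^N -> R) :=
  [set f | f \in Lfun leb 1 /\ (besov_seminorm s f < +oo)%E].

Definition frac_power (s : R) (f : 'R[R]^N -> R) (X : 'R[R]^N) : R :=
  - (s / Gamma (1 - s)) *
  L1_integral lebesgue_measure leb `]0, +oo[
    (fun t Y => (t `^ (1 + s))^-1 * (semigroup t f Y - f Y)) X.

End kolmogorov_operator.

(* Main.v *)
(** Let [n] be the L1 norm of [f]. The Gaussian kernel has mass 1 in [Y], and,
    as [\det (expmx (t *: B)) = 1] when [\tr B = 0], also in [X]; so each [P_t]
    preserves positivity and [n]. From [t K(t) + e^{tB} (t K(t)) e^{tB^T} = 2t K(2t)]
    the determinant of [t K(t)] tends to infinity, hence [P_t f] tends to 0
    uniformly. The part [t <= T] of the integral of [t^{-1-s} (P_t f - f)] is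
    bounded independently of [s] by the Besov seminorm. On [t >= T] the functions
    [P_t f] and [f] both have mass [n] but barely overlap, because
    [min (P_t f) f <= min e f] is small in L1; this part has norm about
    [2 n T^{-s} / s], while [s / Gamma (1 - s) ~ s]. *)
Require Import Defs.
From mathcomp Require Import all_boot all_order all_algebra.
From mathcomp Require Import all_classical all_reals all_analysis.
From mathcomp Require Import measurable_realfun.
From mathcomp Require Import fingroup perm ring lra.

Import Order.TTheory GRing.Theory Num.Theory.
Import numFieldNormedType.Exports.

Local Open Scope classical_set_scope.
Local Open Scope ring_scope.

(* Importing mathcomp shadows [dotmx] by a form on row vectors. *)
Local Notation dotmx := Defs.dotmx.

(** * Matrix exponential *)

(** Two obstacles shape the proof. [Q] may be degenerate, and only the accumulated form [t K(t)] is
    positive definite; determinants are therefore compared through Gaussian integrals rather than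
    eigenvalues, which gives the doubling inequality behind the decay of the kernel. Secondly,
    [L1_integral] picks an unspecified representative of a Bochner integral. Approximating
    integrable functions on the product of time and space by step functions shows that such an
    integral exists and agrees almost everywhere with the pointwise integral in [t], to which
    Tonelli's theorem applies. The limit itself is proved for an abstract kernel of mass 1 in each
    variable, bounded by some [c t] that becomes arbitrarily small. There the splitting time [T] is
    fixed before [s] tends to 0: [T^{-s}] tends to 1, while the part before [T], multiplied by [s],
    vanishes. *)

Section matrix_exponential.
Context {R : realType} {n : nat}.
Implicit Types A B C : 'M[R]_n.

(** A neighbourhood of a matrix contains a product of neighbourhoods of its entries, and finitely
    many eventual conditions hold together. *)
Lemma cvg_mx_entries {m p : nat} (F : set_system nat) {FF : Filter F}
    (u : nat -> 'M[R]_(m, p)) (L : 'M[R]_(m, p)) :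
  (forall i j, u k i j @[k --> F] --> L i j) -> u @ F --> L.
Proof.
move=> uL A [P LP sPA]; rewrite /nbhs /=.
suff : \forall k \near F, forall i j, P i j (u k i j).
  by apply: filterS => k Pk; exact: sPA.
apply: filter_forall => i; apply: filter_forall => j.
exact: uL.
Qed.

(** A majorant of every entry whose powers bound the entries of powers, so that the exponential
    series is dominated by a scalar one. *)
Let abs_sum A : R := \sum_i \sum_j `|A i j|.

Let abs_sum_ge0 A : 0 <= abs_sum A.
Proof. by apply: sumr_ge0 => i _; apply: sumr_ge0. Qed.

Let norm_exprM_le A C k i j : `|(A ^+ k *m C) i j| <= abs_sum A ^+ k * abs_sum C.
Proof.
elim: k i j => [|k ih] i j.
  rewrite expr0 mul1mx mul1r /abs_sum (bigD1 i)//= (bigD1 j)//=.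
  by rewrite -addrA lerDl addr_ge0// sumr_ge0// => k _; rewrite sumr_ge0.
rewrite exprS -mulmxA mxE (le_trans (ler_norm_sum _ _ _))//.
apply: (@le_trans _ _ (\sum_l `|A i l| * (abs_sum A ^+ k * abs_sum C))).
  by apply: ler_sum => l _; rewrite normrM ler_wpM2l.
rewrite -mulr_suml exprS -mulrA ler_wpM2r ?mulr_ge0 ?exprn_ge0//.
rewrite [leRHS](bigD1 i)//= lerDl.
by apply: sumr_ge0 => l _; apply: sumr_ge0.
Qed.

(** Entries of [expmx (t *: A) *m C] are scalar power series in [t]. The factor [C] is carried along
    because differentiating the series replaces [C] by [A *m C], which stays in the family. *)
Let coef A C i j (k : nat) : R := (k`!%:R)^-1 * (A ^+ k *m C) i j.

Let cvg_pseries_coef A C i j x : cvgn (pseries (coef A C i j) x).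
Proof.
apply: normed_cvg; rewrite /normed_series_of /=.
apply: (@series_le_cvg _ _ (abs_sum C *: exp_coeff (abs_sum A * `|x|))); last first.
- exact/is_cvg_seriesZ/is_cvg_series_exp_coeff.
- move=> k; rewrite [leRHS](_ : _ = abs_sum C * (abs_sum A * `|x|) ^+ k / k`!%:R); last first.
    by rewrite -mulrA.
  rewrite /= /coef !normrM normfV normrX [`|k`!%:R|]ger0_norm// exprMn.
  rewrite [leRHS](_ : _ = k`!%:R^-1 * ((abs_sum A ^+ k * abs_sum C) * `|x| ^+ k)).
    by rewrite -[leLHS]mulrA ler_wpM2l// ler_wpM2r// exprn_ge0.
  by ring.
- move=> k; rewrite mulr_ge0//; apply: divr_ge0 => //.
  by rewrite exprn_ge0// mulr_ge0.
- by move=> k /=.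
Qed.

Let pseries_diffs_coef A C i j :
  pseries_diffs (coef A C i j) = coef A (A *m C) i j.
Proof.
apply/funext => k; rewrite /pseries_diffs /coef exprSr mulmxA factS natrM.
by rewrite invfM -mulrA mulrCA !mulrA mulVf ?mul1r// pnatr_eq0.
Qed.

Let exprZmx A (t : R) k : (t *: A) ^+ k = t ^+ k *: A ^+ k.
Proof.
elim: k => [|k ih]; first by rewrite !expr0 scale1r.
rewrite !exprS ih.
by rewrite -[LHS]scalemxAl -scalemxAr scalerA.
Qed.

Let expmx_mul_coef A C t i j :
  (expmx (t *: A) *m C) i j = limn (pseries (coef A C i j) t).
Proof.
have cE : series (fun k => (k`!%:R : R)^-1 *: (t *: A) ^+ k) @ \oo -->
    (\matrix_(i, j) limn (pseries (coef A 1%:M i j) t) : 'M[R]_n).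
  apply: cvg_mx_entries => a b; rewrite mxE.
  have := cvg_pseries_coef A 1%:M a b t; apply: cvg_trans.
  rewrite (_ : (fun k => _) = pseries (coef A 1%:M a b) t)//.
  apply/funext => k; rewrite /pseries /series /= summxE.
  apply: eq_bigr => l _; rewrite /coef mulmx1 exprZmx !mxE.
  by rewrite -mulrA; congr (_ * _); rewrite mulrC.
rewrite /expmx (cvg_lim (@norm_hausdorff _ _) cE) mxE.
have /cvg_lim ->// : pseries (coef A C i j) t @ \oo -->
    (\sum_l (limn (pseries (coef A 1%:M i l) t)) * C l j).
  rewrite (_ : pseries _ _ = fun k => \sum_l pseries (coef A 1%:M i l) t k * C l j).
    apply: cvg_big => [|l _]; first exact: add_continuous.
    by apply: cvgMr_tmp; exact: cvg_pseries_coef.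
  apply/funext => k; rewrite /pseries /series /=.
  under [RHS]eq_bigr do rewrite mulr_suml.
  rewrite exchange_big/=; apply: eq_bigr => m _.
  rewrite /coef mxE -mulrA mulr_suml mulr_sumr; apply: eq_bigr => l _.
  by rewrite mulmx1; ring.
by apply: eq_bigr => l _; rewrite mxE.
Qed.

Let cvg_expmx A t i j : pseries (coef A 1%:M i j) t @ \oo --> expmx (t *: A) i j.
Proof.
by rewrite -[expmx _]mulmx1 expmx_mul_coef; exact: cvg_pseries_coef.
Qed.

Lemma expmx_scale0 A : expmx (0 *: A) = 1%:M.
Proof.
apply/matrixP => i j; rewrite -[LHS](cvg_lim _ (cvg_expmx A 0 i j))//.
(* The partial sum of index 0 is empty; from index 1 on it contains the constant term, and nothing
   else survives at 0. *)
apply/cvg_lim => //; rewrite -(cvg_shiftS _)/=.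
rewrite (_ : (fun _ => _) = cst ((1%:M : 'M[R]_n) i j)); first exact: cvg_cst.
apply/funext => k; rewrite /pseries /series /= big_nat_recl//= big1 => [|l _].
  by rewrite /coef expr0 mul1mx fact0 invr1 mul1r expr0 mulr1 addr0.
by rewrite expr0n mulr0.
Qed.

Lemma trmx_expmx A (t : R) : (expmx (t *: A))^T = expmx (t *: A^T).
Proof.
have trX k : (A ^+ k)^T = (A^T) ^+ k.
  elim: k => [|k ih]; first by rewrite !expr0; exact: trmx1.
  by rewrite exprSr exprS -ih; exact: trmx_mul.
apply/matrixP => i j; rewrite mxE.
rewrite -[LHS](cvg_lim _ (cvg_expmx A t j i))//.
apply/cvg_lim => //.
rewrite (_ : pseries _ _ = pseries (coef A^T 1%:M i j) t); first exact: cvg_expmx.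
by congr pseries; apply/funext => k; rewrite /coef !mulmx1 -trX mxE.
Qed.

Lemma expmx_mxC A (t : R) : A *m expmx (t *: A) = expmx (t *: A) *m A.
Proof.
apply/matrixP => i j; rewrite expmx_mul_coef mxE; apply/esym/cvg_lim => //.
rewrite (_ : pseries _ _ = fun k => \sum_l A i l * pseries (coef A 1%:M l j) t k).
  apply: cvg_big => [|l _]; first exact: add_continuous.
  by apply: cvgMl_tmp; exact: cvg_expmx.
apply/funext => k; rewrite /pseries /series /=.
under [RHS]eq_bigr do rewrite mulr_sumr.
rewrite exchange_big/=; apply: eq_bigr => m _.
have AC : A ^+ m *m A = A *m A ^+ m by rewrite -[LHS]exprSr exprS.
rewrite /coef AC mxE mulr_sumr mulr_suml; apply: eq_bigr => l _.
by rewrite mulmx1; ring.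
Qed.

Lemma is_derive_expmx_mul A C i j (t : R) :
  is_derive t 1 (fun t => (expmx (t *: A) *m C) i j)
    ((expmx (t *: A) *m (A *m C)) i j).
Proof.
rewrite expmx_mul_coef -pseries_diffs_coef.
rewrite (_ : (fun _ => _) = fun t => limn (pseries (coef A C i j) t)); last first.
  by apply/funext => u; rewrite expmx_mul_coef.
(* Any radius beyond [|t|] would do, since the series converges everywhere. *)
apply: (@pseries_snd_diffs _ _ (`|t| + 1)).
- exact: cvg_pseries_coef.
- by rewrite pseries_diffs_coef; exact: cvg_pseries_coef.
- by rewrite !pseries_diffs_coef; exact: cvg_pseries_coef.
- by rewrite [ltRHS]ger0_norm ?ltrDl// addr_ge0.
Qed.

Lemma is_derive_expmx A i j (t : R) :
  is_derive t 1 (fun t => expmx (t *: A) i j) ((expmx (t *: A) *m A) i j).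
Proof.
have := is_derive_expmx_mul A 1%:M i j t; rewrite mulmx1.
by under eq_fun do rewrite mulmx1.
Qed.

(** The product of the exponentials at [r] and at [s + t - r] does not depend on [r]: the two terms
    of its derivative cancel because [A] commutes with its exponential. The values at [r = 0] and
    [r = s] are the two sides. *)
Lemma expmxD A (s t : R) :
  expmx ((s + t) *: A) = expmx (s *: A) *m expmx (t *: A).
Proof.
apply/matrixP => i j.
pose h r := (expmx (r *: A) *m expmx ((s + t - r) *: A)) i j.
have -> : expmx ((s + t) *: A) i j = h 0.
  by rewrite /h expmx_scale0 mul1mx subr0.
have -> : (expmx (s *: A) *m expmx (t *: A)) i j = h s.
  by rewrite /h addrAC subrr add0r.
apply: is_derive_0_is_cst => r.
rewrite /h; under eq_fun do rewrite mxE.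
pose d l := expmx (r *: A) i l *: (- (expmx ((s + t - r) *: A) *m A) l j) +
   expmx ((s + t - r) *: A) l j *: (expmx (r *: A) *m A) i l.
have d0 : \sum_l d l = 0.
  rewrite big_split/=.
  apply/eqP; rewrite addr_eq0; apply/eqP.
  transitivity (- (expmx (r *: A) *m (expmx ((s + t - r) *: A) *m A)) i j).
    by rewrite mxE -sumrN; apply: eq_bigr => l _; rewrite -mulrN.
  rewrite -expmx_mxC mulmxA mxE; congr (- _); apply: eq_bigr => l _.
  by rewrite mulrC.
apply: is_derive_eq d0.
rewrite (_ : (fun _ => _) = \sum_l (fun r => expmx (r *: A) i l * expmx ((s + t - r) *: A) l j)); last first.
  by apply/funext => u; rewrite fct_sumE.
apply: is_derive_sum => l; apply: is_deriveM; first exact: is_derive_expmx.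
have := is_derive_expmx A l j (s + t - r).
have -> : (fun r0 => expmx ((s + t - r0) *: A) l j) =
  (fun t => expmx (t *: A) l j) \o (fun r => s + t - r) by [].
move=> H.
rewrite -[X in is_derive _ _ _ X]mulrN1; apply: is_derive1_comp.
have : is_derive r 1 (cst (s + t) - id) (0 - 1) by apply: is_deriveB.
by rewrite sub0r.
Qed.

End matrix_exponential.

(** * Determinant of the exponential of a traceless matrix *)

Section derivative_of_determinant.
Context {R : realType}.

(** Leibniz rule; [uniq r] ensures that the condition [i != j] removes exactly one factor. *)
Lemma is_derive_prod {I : eqType} (r : seq I) (f : I -> R -> R) (d : I -> R)
    (x : R) : uniq r -> (forall i, is_derive x 1 (f i) (d i)) ->
  is_derive x 1 (fun t => \prod_(i <- r) f i t)
    (\sum_(j <- r) d j * \prod_(i <- r | i != j) f i x).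
Proof.
move=> + fd; elim: r => [_|a r ih /= /andP[ar ur]].
  rewrite big_nil; under eq_fun do rewrite big_nil.
  exact: is_derive_cst.
under eq_fun do rewrite big_cons.
rewrite big_cons big_cons eqxx/=.
apply: (is_derive_eq (is_deriveM (fd a) (ih ur))).
rewrite addrC /GRing.scale/= mulrC; congr (_ * _ + _).
  rewrite big_seq_cond [RHS]big_seq_cond; apply: eq_bigl => i.
  by rewrite andbT; case: eqVneq => [->|]; rewrite ?(negbTE ar)// andbT.
rewrite mulr_sumr; apply: eq_big_seq => j jr.
rewrite big_cons ifT; first by rewrite mulrCA.
by apply: contraNneq ar => ->.
Qed.

Lemma is_derive_bigsum {I : Type} (r : seq I) (f : I -> R -> R) (d : I -> R)
    (x : R) : (forall i, is_derive x 1 (f i) (d i)) ->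
  is_derive x 1 (fun t => \sum_(i <- r) f i t) (\sum_(i <- r) d i).
Proof.
move=> fd; elim: r => [|a r ih].
  by rewrite big_nil; under eq_fun do rewrite big_nil; exact: is_derive_cst.
rewrite big_cons; under eq_fun do rewrite big_cons.
exact: is_deriveD.
Qed.

(** In the Leibniz expansion, a permutation other than the identity moves at least two indices;
    after one factor is differentiated there remains an off-diagonal entry of the identity matrix,
    so only the diagonal term contributes. *)
Lemma is_derive_det1 {n : nat} (F : R -> 'M[R]_n) (D : 'M[R]_n) (x : R) :
  F x = 1%:M -> (forall i j, is_derive x 1 (fun t => F t i j) (D i j)) ->
  is_derive x 1 (fun t => \det (F t)) (\tr D).
Proof.
move=> F1 dF.
have E : \sum_(s : 'S_n) (-1) ^+ s *:
    (\sum_(j < n) D j (s j) * \prod_(i < n | i != j) F x i (s i)) = \tr D.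
  rewrite (bigD1 1%g)//= [X in _ + X]big1 => [|s s1].
    rewrite addr0 odd_perm1 expr0 scale1r; apply: eq_bigr => j _.
    rewrite perm1 big1 ?mulr1// => i _.
    by rewrite perm1 F1 mxE eqxx.
  rewrite big1 ?scaler0// => j _.
  (* If [s] fixed every index but [j], injectivity would make it fix [j] as well. *)
  have [i ij si] : exists2 i, i != j & s i != i.
    apply: contrapT => H; move/eqP: s1; apply.
    have fx i : i != j -> s i = i.
      move=> ij; apply/eqP/negPn/negP => si; apply: H; by exists i.
    apply/permP => i; rewrite perm1; have [->|/fx//] := eqVneq i j.
    by have [//|/fx/perm_inj] := eqVneq (s j) j.
  by rewrite (bigD1 i)//= F1 mxE eq_sym (negbTE si) mul0r mulr0.
apply: is_derive_eq E.
apply: (@is_derive_bigsum _ _ (fun (s : 'S_n) t => (-1) ^+ s *: \prod_i F t i (s i))) => s.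
apply: is_deriveZ.
apply: (@is_derive_prod _ _ (fun i t => F t i (s i)) (fun i => D i (s i))) => //.
exact: index_enum_uniq.
Qed.

(** By [expmxD] the determinant is multiplicative in time, so its derivative at any [x] is a
    multiple of its derivative at 0, which is the trace. *)
Lemma det_expmx {n : nat} (A : 'M[R]_n) (t : R) :
  \tr A = 0 -> \det (expmx (t *: A)) = 1.
Proof.
move=> trA0; pose w t := \det (expmx (t *: A)).
have w0 : is_derive (0 : R) 1 w 0.
  rewrite -[X in is_derive _ _ _ X]trA0; apply: is_derive_det1.
    exact: expmx_scale0.
  by move=> i j; have := is_derive_expmx A i j 0; rewrite expmx_scale0 mul1mx.
have -> : \det (expmx (t *: A)) = w 0.
  apply: is_derive_0_is_cst => x.
  rewrite (_ : w = w x \*: (w \o (fun u => u - x))); last first.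
    apply/funext => u /=; rewrite /w /GRing.scale/= -det_mulmx -expmxD.
    by rewrite addrCA subrr addr0.
  have : is_derive x 1 (id - cst x) (1 - 0) by apply: is_deriveB.
  rewrite subr0 => dx.
  rewrite -(scaler0 _ (w x)); apply: is_deriveZ.
  rewrite -(mul0r 1); apply: is_derive1_comp => //=.
  by rewrite subrr.
by rewrite /w expmx_scale0 det1.
Qed.

End derivative_of_determinant.

(** * Measurability of matrix-valued functions *)

Lemma measurable_funV d (W : measurableType d) {R : realType} (D : set W) (f : W -> R) :
  measurable_fun D f -> measurable_fun D (fun w => (f w)^-1).
Proof.
move=> mf.
(* Squaring gives a nonnegative base, for which [powR] with exponent -1 is the inverse; at a zero of
   [f] both sides are 0 by convention. *)
have -> : (fun w => (f w)^-1) = fun w => f w * (f w ^+ 2) `^ (-1).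
  apply/funext => w; rewrite powR_inv1 ?sqr_ge0// expr2 invfM.
  by have [->|w0] := eqVneq (f w) 0; rewrite ?invr0 ?mul0r// mulVKf.
apply: measurable_funM => //.
apply: (measurableT_comp (measurable_powR _)).
exact: measurable_funX.
Qed.

Section measurable_matrices.
Context {d} {W : measurableType d} {R : realType} (D : set W).

Definition measurable_mx {m n : nat} (F : W -> 'M[R]_(m, n)) :=
  forall i j, measurable_fun D (fun w => F w i j).

Lemma measurable_mx_mul {m n p : nat} (F : W -> 'M[R]_(m, n)) (G : W -> 'M[R]_(n, p)) :
  measurable_mx F -> measurable_mx G -> measurable_mx (fun w => F w *m G w).
Proof.
move=> mF mG i j; under eq_fun do rewrite mxE.
by apply: measurable_sum => k; apply: measurable_funM.
Qed.

Lemma measurable_mx_tr {m n : nat} (F : W -> 'M[R]_(m, n)) :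
  measurable_mx F -> measurable_mx (fun w => (F w)^T).
Proof. by move=> mF i j; under eq_fun do rewrite mxE; exact: mF. Qed.

Lemma measurable_mxB {m n : nat} (F G : W -> 'M[R]_(m, n)) :
  measurable_mx F -> measurable_mx G -> measurable_mx (fun w => F w - G w).
Proof.
move=> mF mG i j; under eq_fun do rewrite !mxE.
by apply: measurable_funB; [exact: mF|exact: mG].
Qed.

Lemma measurable_mx_cst {m n : nat} (A : 'M[R]_(m, n)) : measurable_mx (fun=> A).
Proof. by move=> i j; exact: measurable_cst. Qed.

Lemma measurable_dotmx {n : nat} (F G : W -> 'cV[R]_n) :
  measurable_mx F -> measurable_mx G -> measurable_fun D (fun w => dotmx (F w) (G w)).
Proof.
move=> mF mG; apply: (measurable_mx_mul (fun w => (F w)^T)) => //.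
exact: measurable_mx_tr.
Qed.

Lemma measurable_det {n : nat} (F : W -> 'M[R]_n) :
  measurable_mx F -> measurable_fun D (fun w => \det (F w)).
Proof.
move=> mF; apply: measurable_sum => s; apply: measurable_funM => //.
by apply: measurable_prod => i _; exact: mF.
Qed.

Lemma measurable_mx_adj {n : nat} (F : W -> 'M[R]_n) :
  measurable_mx F -> measurable_mx (fun w => \adj (F w)).
Proof.
move=> mF i j; under eq_fun do rewrite mxE /cofactor.
apply: measurable_funM => //; apply: measurable_det => a b.
by under eq_fun do rewrite !mxE; exact: mF.
Qed.

(** The adjugate formula is measurable in the entries; invertibility on [D] excludes the default
    branch of [invmx]. *)
Lemma measurable_mx_inv {n : nat} (F : W -> 'M[R]_n) :
  measurable_mx F -> (forall w, D w -> F w \in unitmx) ->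
  measurable_mx (fun w => invmx (F w)).
Proof.
move=> mF uF i j.
apply: (eq_measurable_fun (fun w => (\det (F w))^-1 * (\adj (F w)) i j)).
  by move=> w /set_mem/uF uw; rewrite /invmx uw [RHS]mxE.
apply: measurable_funM; last exact: measurable_mx_adj.
apply: measurable_funV; exact: measurable_det.
Qed.

End measurable_matrices.

(** * Gaussian integrals *)

Section gaussian_integral.
Context {R : realType}.

Definition posdefmx {n : nat} (S : 'M[R]_n) :=
  S^T = S /\ forall v : 'cV[R]_n, v != 0 -> 0 < dotmx (S *m v) v.

Lemma integral_gauss_line (a c : R) : 0 < a ->
  (\int[lebesgue_measure]_x (expR (- (a * (x - c) ^+ 2)))%:E =
   (Num.sqrt (pi / a))%:E)%E.
Proof.
(* The standard deviation with [2 s^2 = 1 / a], for which the integrand is a multiple of a normal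
   density. *)
move=> a0; pose s := (Num.sqrt (a *+ 2))^-1.
have s2 : s ^+ 2 *+ 2 = a^-1.
  rewrite exprVn sqr_sqrtr ?mulrn_wge0 ?ltW// -mulr_natr.
  by rewrite -[a *+ 2]mulr_natr invfM mulfVK.
have s0 : s != 0 by rewrite invr_neq0// sqrtr_eq0 -ltNge mulrn_wgt0.
have pa : 0 < pi / a by rewrite divr_gt0 ?pi_gt0.
transitivity (\int[lebesgue_measure]_x
    ((Num.sqrt (pi / a))%:E * (normal_pdf c s x)%:E))%E.
  apply: eq_integral => x _; rewrite normal_pdfE// -EFinM; congr EFin.
  rewrite /normal_peak /normal_fun.
  have -> : s ^+ 2 * pi *+ 2 = pi / a by rewrite -mulrnAl s2 mulrC.
  rewrite mulVKf ?gt_eqF ?sqrtr_gt0//.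
  by rewrite s2 invrK mulNr mulrC.
rewrite ge0_integralZl_EFin//.
- by rewrite integral_normal_pdf mule1.
- by move=> x _; rewrite lee_fin normal_pdf_ge0.
- by apply/measurable_EFinP; exact: measurable_normal_pdf.
Qed.

Lemma colvec_cons {n : nat} (x : R) (y : 'R[R]^n) :
  colvec (tuple_cons (x, y)) = col_mx x%:M (colvec y) :> 'cV[R]_(1 + n).
Proof.
apply/matrixP => i j; rewrite !mxE ord1; case: splitP => k.
  rewrite ord1 => /= i0; rewrite (_ : i = ord0) ?mxE; last exact: val_inj.
  by rewrite eqxx mulr1n (tnth_nth x).
by move=> /= ik; rewrite mxE !(tnth_nth x) ik.
Qed.

Lemma measurable_colvec {n : nat} :
  measurable_mx setT (@colvec R n).
Proof. by move=> i j; under eq_fun do rewrite mxE; exact: measurable_tnth. Qed.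

Section dotmx_theory.
Context {n : nat}.
Implicit Types u v w : 'cV[R]_n.

Lemma dotmxE v w : dotmx v w = \sum_i v i 0 * w i 0.
Proof. by rewrite /dotmx mxE; apply: eq_bigr => i _; rewrite mxE. Qed.

Lemma dotmxC v w : dotmx v w = dotmx w v.
Proof. by rewrite !dotmxE; apply: eq_bigr => i _; rewrite mulrC. Qed.

Lemma dotmxDr u v w : dotmx u (v + w) = dotmx u v + dotmx u w.
Proof. by rewrite /dotmx mulmxDr mxE. Qed.

Lemma dotmxDl u v w : dotmx (v + w) u = dotmx v u + dotmx w u.
Proof. by rewrite dotmxC dotmxDr !(dotmxC u). Qed.

Lemma dotmxZr k v w : dotmx v (k *: w) = k * dotmx v w.
Proof. by rewrite /dotmx -scalemxAr mxE. Qed.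

Lemma dotmxZl k v w : dotmx (k *: v) w = k * dotmx v w.
Proof. by rewrite dotmxC dotmxZr dotmxC. Qed.

Lemma dotmx_adj {m} (A : 'M[R]_(n, m)) (v : 'cV[R]_n) (w : 'cV[R]_m) :
  dotmx v (A *m w) = dotmx (A^T *m v) w.
Proof. by rewrite /dotmx trmx_mul trmxK mulmxA. Qed.

End dotmx_theory.

Lemma dotmx_col {m n : nat} (x x' : 'cV[R]_m) (y y' : 'cV[R]_n) :
  dotmx (col_mx x y) (col_mx x' y') = dotmx x x' + dotmx y y'.
Proof. by rewrite /dotmx tr_col_mx mul_row_col mxE. Qed.

Lemma dotmx11 (x y : 'cV[R]_1) : dotmx x y = x 0 0 * y 0 0.
Proof. by rewrite dotmxE big_ord1. Qed.

Section schur_complement.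
Context {n : nat} (a : R) (b : 'rV[R]_n) (D : 'M[R]_n).
Hypothesis a0 : a != 0.

Definition schur : 'M[R]_n := D - a^-1 *: (b^T *m b).

Lemma det_schur : \det (block_mx a%:M b b^T D : 'M[R]_(1 + n)) = a * \det schur.
Proof.
have -> : block_mx a%:M b b^T D =
    block_mx 1%:M 0 (a^-1 *: b^T) 1%:M *m block_mx a%:M b 0 schur
    :> 'M[R]_(1 + n).
  rewrite mulmx_block !mul1mx !mul0mx !addr0.
  rewrite mul_mx_scalar scalerA mulfV// scale1r /schur -scalemxAl.
  by rewrite addrC subrK.
by rewrite det_mulmx det_lblock det_ublock !det1 !mul1r det_scalar1.
Qed.

(** Completing the square in the first coordinate: for fixed [y] the form is a one-dimensional
    Gaussian exponent in [x] plus a remainder in [y] alone. *)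
Lemma dotmx_schur (x : R) (y : 'cV[R]_n) :
  dotmx ((block_mx a%:M b b^T D : 'M[R]_(1 + n)) *m col_mx x%:M y)
        (col_mx x%:M y : 'cV[R]_(1 + n)) =
  a * (x + a^-1 * (b *m y) 0 0) ^+ 2 + dotmx (schur *m y) y.
Proof.
rewrite mul_block_col dotmx_col dotmx11 dotmxDl !mxE big_ord1 !mxE eqxx !mulr1n.
rewrite [X in _ + (X + _)]dotmxC dotmx_adj trmxK dotmx11 !mxE eqxx mulr1n.
rewrite /schur mulmxBl -scalemxAl -scaleNr dotmxDl dotmxZl.
rewrite -mulmxA (dotmxC (b^T *m _)) dotmx_adj trmxK dotmx11 !mxE.
by field.
Qed.

(* The Schur complement is the form minimised over the first coordinate. *)
Lemma posdefmx_schur :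
  posdefmx (block_mx a%:M b b^T D : 'M[R]_(1 + n)) -> posdefmx schur.
Proof.
move=> [sym pos]; split.
  move: sym; rewrite tr_block_mx => /eq_block_mx[_ _ _ DT].
  by rewrite /schur linearB/= linearZ/= trmx_mul trmxK DT.
move=> v v0; have := pos (col_mx (- (a^-1 * (b *m v) 0 0))%:M v).
rewrite dotmx_schur addNr expr0n/= mulr0 add0r; apply.
apply: contra_neq v0 => /(congr1 dsubmx).
by rewrite col_mxKd linear0.
Qed.

End schur_complement.

Lemma posdefmx_block {n : nat} (S : 'M[R]_(1 + n)) : posdefmx S ->
  exists a b D, 0 < a /\ S = block_mx a%:M b b^T D.
Proof.
move=> pS; exists (S 0 0), (ursubmx S), (drsubmx S); split.
  have [_ pos] := pS; have := pos (delta_mx 0 0).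
  rewrite -colE dotmxE (bigD1 0)//= big1 => [|i i0]; last first.
    by rewrite [X in _ * X]mxE (negbTE i0) mulr0.
  rewrite !mxE eqxx mulr1 addr0; apply.
  by apply/eqP => /matrixP/(_ 0 0); rewrite !mxE eqxx => /eqP; rewrite oner_eq0.
have [sym _] := pS.
rewrite -[LHS]submxK; congr block_mx.
  by rewrite [LHS]mx11_scalar !mxE; congr (S _ _)%:M; exact: val_inj.
by rewrite trmx_ursub sym.
Qed.

Lemma measurable_gauss {n : nat} (S : 'M[R]_n) (m : 'cV[R]_n) :
  measurable_fun setT (fun x : 'R[R]^n =>
    (expR (- dotmx (S *m (colvec x - m)) (colvec x - m)))%:E).
Proof.
apply/measurable_EFinP; apply: measurableT_comp => //; apply: measurableT_comp => //.
have mB : measurable_mx setT (fun x : 'R[R]^n => colvec x - m).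
  by apply: measurable_mxB; [exact: measurable_colvec|exact: measurable_mx_cst].
apply: measurable_dotmx => //.
by apply: measurable_mx_mul => //; exact: measurable_mx_cst.
Qed.

(** Induction by Tonelli: the integral in the first coordinate is [sqrt (pi / a)] whatever its
    centre, and the rest is the Gaussian of the Schur complement. Positivity of the determinant goes
    through the same induction and is needed to multiply the square roots. *)
Lemma integral_gauss {n : nat} (S : 'M[R]_n) (m : 'cV[R]_n) : posdefmx S ->
  0 < \det S /\
  (\int[lebesgue_tuple R n]_x
     (expR (- dotmx (S *m (colvec x - m)) (colvec x - m)))%:E =
   (Num.sqrt (pi ^+ n / \det S))%:E)%E.
Proof.
elim: n S m => [|n ih] S m pS.
  rewrite det_mx00; split => //.
  have mg := measurable_gauss S m.
  rewrite integral_dirac//= diracT mul1e divr1 sqrtr1.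
  by rewrite /dotmx mxE big_ord0 oppr0 expR0.
have [a [b [D [a0 SE]]]] := @posdefmx_block n S pS.
have an0 : a != 0 by rewrite gt_eqF.
have pSc : posdefmx (schur a b D).
  by apply: posdefmx_schur => //; rewrite -SE.
have [dS' IS'] := ih _ (dsubmx (m : 'cV_(1 + n))) pSc.
have dS : \det S = a * \det (schur a b D) by rewrite SE -det_schur.
rewrite dS; split; first by rewrite mulr_gt0.
rewrite /= /lebesgue_cons ge0_integral_pushforward//=; last 2 first.
  exact: measurable_tuple_cons.
  exact: measurable_gauss.
rewrite preimage_setT.
rewrite fubini_tonelli2//=; last first.
  exact: (measurableT_comp (measurable_gauss S m) (@measurable_tuple_cons R n)).
rewrite /fubini_G /=.
(* For fixed [y], the value of the first coordinate at which the form is minimal. *)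
pose c (y : 'R[R]^n) := (m : 'cV_(1 + n)) 0 0 - a^-1 * (b *m (colvec y - dsubmx (m : 'cV_(1 + n)))) 0 0.
have E x y : dotmx (S *m (colvec (tuple_cons (x, y)) - m)) (colvec (tuple_cons (x, y)) - m) =
    a * (x - c y) ^+ 2 +
    dotmx (schur a b D *m (colvec y - dsubmx (m : 'cV_(1 + n)))) (colvec y - dsubmx (m : 'cV_(1 + n))).
  rewrite colvec_cons.
  have -> : col_mx x%:M (colvec y) - m =
      col_mx (x - (m : 'cV_(1 + n)) 0 0)%:M (colvec y - dsubmx (m : 'cV_(1 + n))) :> 'cV_(1 + n).
    apply/matrixP => i j; rewrite !mxE ord1; case: splitP => k ik.
      have -> : i = 0 by apply: val_inj; rewrite /= ik ord1.
      by rewrite !mxE ord1 eqxx !mulr1n.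
    have -> : i = rshift 1 k by exact: val_inj.
    by rewrite !mxE.
  by rewrite SE dotmx_schur//; congr (a * _ ^+ 2 + _); rewrite /c opprB addrA addrAC.
transitivity (\int[lebesgue_tuple R n]_y
   ((Num.sqrt (pi / a))%:E *
      (expR (- dotmx (schur a b D *m (colvec y - dsubmx (m : 'cV_(1 + n))))
        (colvec y - dsubmx (m : 'cV_(1 + n)))))%:E))%E.
  apply: eq_integral => y _.
  rewrite -(@integral_gauss_line a (c y))// -ge0_integralZr//=.
  - by apply: eq_integral => x _; rewrite E opprD expRD EFinM.
  - apply/measurable_EFinP; apply: measurableT_comp => //; apply: measurableT_comp => //.
    by apply: measurable_funM => //; apply: measurable_funX; apply: measurable_funB.
rewrite ge0_integralZl_EFin//; last first.
  exact: measurable_gauss.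
rewrite IS' -EFinM -sqrtrM ?divr_ge0 ?pi_ge0 ?ltW//.
by rewrite invfM mulrACA -exprS.
Qed.

End gaussian_integral.

(** * Determinant inequalities from Gaussian integrals *)

Section determinant_comparison.
Context {R : realType} {n : nat}.
Implicit Types S A C : 'M[R]_n.

Lemma posdefmx_det_gt0 S : posdefmx S -> 0 < \det S.
Proof. by move=> /(integral_gauss S 0)[]. Qed.

Let gauss S : \bar R :=
  \int[lebesgue_tuple R n]_x
     (expR (- dotmx (S *m (colvec x - 0)) (colvec x - 0)))%:E.

(** The Gaussian integral [sqrt (pi^n / det)] decreases in the determinant, so a pointwise
    comparison of integrands becomes a comparison of determinants. *)
Let le_gauss_det S A : posdefmx S -> posdefmx A ->
  (gauss S <= gauss A)%E -> \det A <= \det S.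
Proof.
move=> pS pA; rewrite /gauss.
have [dS ->] := integral_gauss S 0 pS; have [dA ->] := integral_gauss A 0 pA.
rewrite lee_fin ler_sqrt; last by rewrite divr_ge0 ?exprn_ge0 ?pi_ge0 ?ltW.
by rewrite ler_pM2l ?exprn_gt0 ?pi_gt0// lef_pV2.
Qed.

Lemma le_det_posdefmx A S : posdefmx A -> posdefmx S ->
  (forall v : 'cV_n, dotmx (A *m v) v <= dotmx (S *m v) v) -> \det A <= \det S.
Proof.
move=> pA pS AS; apply: (le_gauss_det S A pS pA); rewrite /gauss.
apply: ge0_le_integral => //; [exact: measurable_gauss..|].
by move=> x _; rewrite lee_fin ler_expR lerN2.
Qed.

(* Convexity of [exp], integrated against Lebesgue measure: a weak form of
   Minkowski's determinant inequality. *)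
Lemma det_add_posdefmx A C S : posdefmx A -> posdefmx C -> posdefmx S ->
  \det C = \det A ->
  (forall v : 'cV_n, dotmx (S *m v) v = dotmx (A *m v) v + dotmx (C *m v) v) ->
  2 ^+ n * \det A <= \det S.
Proof.
move=> pA pC pS CA SAC.
(* Convexity is used at the midpoint of the forms of [A] and [C]; the halving accounts for the
   factor [2 ^+ n]. *)
have ph : posdefmx (2^-1 *: S).
  split; first by rewrite linearZ/= pS.1.
  by move=> v v0; rewrite -scalemxAl dotmxZl mulr_gt0 ?invr_gt0// pS.2.
have : \det A <= \det (2^-1 *: S).
  apply: (le_gauss_det _ _ ph pA).
  apply: (@le_trans _ _ (2^-1%:E * (gauss A + gauss C))%E); last first.
    rewrite /gauss.
    have [dA ->] := integral_gauss A 0 pA; have [dC ->] := integral_gauss C 0 pC.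
    rewrite CA -EFinD -EFinM lee_fin -[X in _ * (X + _)]mul1r -[X in _ * (_ + X)]mul1r.
    by rewrite -mulrDl mulrA mulVf// mul1r.
  rewrite /gauss -ge0_integralD//=; [|exact: measurable_gauss..].
  have mm := emeasurable_funD (measurable_gauss A 0) (measurable_gauss C 0).
  rewrite -ge0_integralZl_EFin//; last first.
    by move=> x _; apply: adde_ge0; rewrite lee_fin expR_ge0.
  apply: ge0_le_integral => //.
  - exact: measurable_gauss.

  - exact: measurable_funeM.
  - move=> x _; rewrite subr0 -EFinD -EFinM lee_fin -scalemxAl dotmxZl SAC.
    set a := dotmx _ _; set c := dotmx _ _.
    have expR_half (z : R) : expR (- z) = expR (- (2^-1 * z)) ^+ 2.
      by rewrite -expRM_natl; congr expR; rewrite mulrN mulrA mulfV// mul1r.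
    rewrite (expR_half a) (expR_half c) mulrDr opprD expRD.
    have := sqr_ge0 (expR (- (2^-1 * a)) - expR (- (2^-1 * c))).
    by set p := expR _; set q := expR _ => pq; lra.
rewrite detZ exprVn mulrC ler_pdivlMr ?exprn_gt0//.
by rewrite mulrC.
Qed.

(** If the form vanishes at [v], its nonnegativity at [v + k w] with [w = S v] reads
    [0 <= 2 k |w|^2 + k^2 c] for all real [k], which forces [w = 0] and then [v = 0]. *)
Lemma posdefmx_unit S : psdmx S -> S \in unitmx -> posdefmx S.
Proof.
move=> [sS pS] uS; split => // v v0; rewrite lt_neqAle pS andbT eq_sym.
apply: contra_neq v0 => Sv0.
pose w := S *m v; pose b := dotmx w w; pose c := dotmx (S *m w) w.
have c0 : 0 <= c by exact: pS.
have b0 : 0 <= b by rewrite /b dotmxE sumr_ge0// => i _; rewrite -expr2 sqr_ge0.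
have quad k : 0 <= 2 * k * b + k ^+ 2 * c.
  have := pS (v + k *: w); rewrite mulmxDr -scalemxAr !(dotmxDl, dotmxDr, dotmxZl, dotmxZr) Sv0.
  rewrite -/c -/w -/b (dotmxC _ v) dotmx_adj sS -/w -/b.
  by rewrite (_ : _ + _ = 2 * k * b + k ^+ 2 * c)//; ring.
have bz : b = 0.
  have c1 : 0 < c + 1 by rewrite ltr_wpDl.
  (* Dividing by [c + 1] rather than by [c] also covers [c = 0], and the value is still negative
     unless [b = 0]. *)
  have := quad (- b / (c + 1)).
  rewrite (_ : _ + _ = - (b ^+ 2) * ((c + 2) / (c + 1) ^+ 2)); last by field; rewrite gt_eqF.
  rewrite mulNr oppr_ge0 pmulr_lle0 ?divr_gt0 ?exprn_gt0 ?ltr_wpDl//.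
  by move=> b20; apply/eqP; rewrite -sqrf_eq0 eq_le b20 sqr_ge0.
have w0 : w = 0.
  apply/matrixP => i j; rewrite ord1 [RHS]mxE.
  move: bz; rewrite /b dotmxE => /eqP; rewrite psumr_eq0 => [/allP/(_ i)|k _].
    by rewrite mem_index_enum => /(_ isT); rewrite /= mulf_eq0 orbb => /eqP.
  by rewrite -expr2 sqr_ge0.
by rewrite -(mulKmx uS v) -/w w0 mulmx0.
Qed.

Lemma posdefmx_inv S : posdefmx S -> posdefmx (invmx S).
Proof.
move=> pS; have uS : S \in unitmx by rewrite unitmxE unitfE gt_eqF// posdefmx_det_gt0.
split; first by rewrite trmx_inv pS.1.
move=> v v0; have := pS.2 (invmx S *m v).
rewrite mulmxA mulmxV// mul1mx dotmxC; apply.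
by apply: contra_neq v0 => /(congr1 (mulmx S)); rewrite mulmxA mulmxV// mul1mx mulmx0.
Qed.

Lemma posdefmx_congr S A : A \in unitmx -> posdefmx S -> posdefmx (A^T *m S *m A).
Proof.
move=> uA pS; split; first by rewrite !trmx_mul trmxK pS.1 mulmxA.
move=> v v0; rewrite -!mulmxA dotmxC dotmx_adj trmxK dotmxC; apply: pS.2.
by apply: contra_neq v0 => /(congr1 (mulmx (invmx A))); rewrite mulmxA mulVmx// mul1mx mulmx0.
Qed.

Lemma posdefmxZ S (k : R) : 0 < k -> posdefmx S -> posdefmx (k *: S).
Proof.
move=> k0 pS; split; first by rewrite linearZ/= pS.1.
by move=> v v0; rewrite -scalemxAl dotmxZl mulr_gt0// pS.2.
Qed.

End determinant_comparison.

(** * Covariance and Gaussian kernel *)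

Section integrals_of_continuous_functions.
Context {R : realType}.
Local Notation mu := (@lebesgue_measure R).

Lemma integrable_continuous_itv (h : R -> R) (a b : R) : continuous h ->
  mu.-integrable `[a, b] (EFin \o h).
Proof.
move=> ch; apply: continuous_compact_integrable; first exact: segment_compact.
exact: continuous_subspaceT.
Qed.

Lemma Rintegral_itv_shift (h : R -> R) (t s : R) : continuous h -> 0 <= s ->
  (\int[mu]_(x in `[t, t + s]) h x = \int[mu]_(x in `[0, s]) h (t + x))%R.
Proof.
move=> ch s0; rewrite /Rintegral; congr fine.
have d (x : R) : is_derive x 1 (fun x => t + x) 1.
  have : is_derive x 1 (cst t + id) (0 + 1) by apply: is_deriveD.
  by rewrite add0r.
have d1 : derive1 (fun x : R => t + x) = cst 1.
  by apply/funext => x; rewrite derive1E; exact: derive_val.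
have := @integration_by_substitution_increasing R (fun x => t + x) h 0 s s0.
rewrite addr0 d1 => ->.
- by apply: eq_integral => x _ /=; rewrite mulr1.
- by move=> x y _ _ xy; rewrite ltrD2l.
- by move=> x _; exact: cst_continuous.
- exact: is_cvg_cst.
- exact: is_cvg_cst.
- split => [x _|//|]; first by have [] := d x.
    apply: cvg_at_right_filter; apply: cvgD; [exact: cvg_cst|exact: cvg_id].
  apply: cvg_at_left_filter; apply: cvgD; [exact: cvg_cst|exact: cvg_id].
- exact: continuous_subspaceT.
Qed.

Lemma Rintegral_itv_cat (h : R -> R) (t s : R) : continuous h -> 0 <= t -> 0 <= s ->
  (\int[mu]_(x in `[0, t + s]) h x =
   \int[mu]_(x in `[0, t]) h x + \int[mu]_(x in `[0, s]) h (t + x))%R.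
Proof.
move=> ch t0 s0; rewrite -Rintegral_itv_shift//.
have ts : t <= t + s by rewrite lerDl.
have := @Rintegral_itvB R h (BLeft 0) (BRight (t + s)) t (integrable_continuous_itv h 0 (t + s) ch).
rewrite !bnd_simp => /(_ t0 ts) /eqP.
rewrite subr_eq [X in _ == X]addrC => /eqP ->; congr (_ + _).
rewrite Rintegral_itv_obnd_cbnd//.
apply: integrableS (integrable_continuous_itv h t (t + s) ch) => //.
exact: subset_itv_oc_cc.
Qed.

Lemma Rintegral_sum {I : Type} (r : seq I) (h : I -> R -> R) (a b : R) :
  (forall i, continuous (h i)) ->
  (\int[mu]_(x in `[a, b]) (\sum_(i <- r) h i x) =
   \sum_(i <- r) \int[mu]_(x in `[a, b]) h i x)%R.
Proof.
move=> ch; elim: r => [|i r ih].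
  rewrite big_nil; under eq_Rintegral do rewrite big_nil.
  by rewrite Rintegral_cst// mul0r.
rewrite big_cons -ih -RintegralD//.
- by apply: eq_Rintegral => x _; rewrite big_cons.
- exact: integrable_continuous_itv.
- apply: integrable_continuous_itv.
  elim: r {ih} => [|j r ih]; first by under eq_fun do rewrite big_nil; exact: cst_continuous.
  under eq_fun do rewrite big_cons.
  by move=> x; apply: cvgD; [exact: ch|exact: ih].
Qed.

Lemma Rintegral_itv0_continuous (h : R -> R) (t : R) : continuous h -> 0 < t ->
  {for t, continuous (fun t : R => \int[mu]_(x in `[0%R, t]) h x)%R}.
Proof.
(* The endpoint [t + 1] makes [t] an interior point, where the fundamental theorem of calculus gives
   a derivative. *)
move=> ch t0; have tt : t < t + 1 by rewrite ltrDl.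
have [dF _] := continuous_FTC1_closed tt (integrable_continuous_itv h 0 (t + 1) ch) t0 (ch t).
exact/differentiable_continuous/derivable1_diffP.
Qed.

End integrals_of_continuous_functions.

Section covariance_matrix.
Context {R : realType} {N : nat} (Q B : 'M[R]_N).
Local Notation mu := (@lebesgue_measure R).

Definition gram (s : R) : 'M[R]_N := expmx (s *: B) *m Q *m expmx (s *: B^T).

(** Half the covariance of the transition kernel. Without the factor [1 / t] it is additive in time,
    up to conjugation by the flow. *)
Definition covmx (t : R) : 'M[R]_N := t *: Kmx Q B t.

Lemma continuous_expmx (A : 'M[R]_N) i j : continuous (fun s : R => expmx (s *: A) i j).
Proof.
move=> s; have [dE _] := is_derive_expmx A i j s.
exact/differentiable_continuous/derivable1_diffP.
Qed.

Lemma continuous_bigsum {I : Type} (r : seq I) (h : I -> R -> R) :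
  (forall i, continuous (h i)) -> continuous (fun x => \sum_(i <- r) h i x).
Proof.
move=> ch x; elim: r => [|j r ih]; first by under eq_fun do rewrite big_nil; exact: cst_continuous.
under eq_fun do rewrite big_cons.
by apply: cvgD; [exact: ch|exact: ih].
Qed.

Lemma continuous_mx_mul {m n p : nat} (F : R -> 'M[R]_(m, n)) (G : R -> 'M[R]_(n, p)) :
  (forall i j, continuous (fun s => F s i j)) ->
  (forall i j, continuous (fun s => G s i j)) ->
  forall i j, continuous (fun s => (F s *m G s) i j).
Proof.
move=> cF cG i j; under eq_fun do rewrite mxE.
by apply: continuous_bigsum => l s; apply: cvgM; [exact: cF|exact: cG].
Qed.

Lemma continuous_mx_cst {m n : nat} (A : 'M[R]_(m, n)) i j : continuous (fun _ : R => A i j).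
Proof. exact: cst_continuous. Qed.

Lemma continuous_gram i j : continuous (fun s => gram s i j).
Proof.
apply: continuous_mx_mul; last exact: continuous_expmx.
by apply: continuous_mx_mul; [exact: continuous_expmx|exact: continuous_mx_cst].
Qed.

Lemma continuous_gram_mul v i j : continuous (fun s => (gram s *m v : 'cV_N) i j).
Proof.
by apply: continuous_mx_mul; [exact: continuous_gram|exact: continuous_mx_cst].
Qed.

Lemma covmxE t i j : 0 < t ->
  covmx t i j = (\int[mu]_(s in `[0%R, t]) gram s i j)%R.
Proof. by move=> t0; rewrite /covmx /Kmx !mxE mulrA mulfV ?mul1r// gt_eqF. Qed.

Lemma continuous_dotmx_gram v : continuous (fun s => dotmx (gram s *m v) v).
Proof.
under eq_fun do rewrite dotmxE.
by apply: continuous_bigsum => k s; apply: cvgM; [exact: continuous_gram_mul|exact: cvg_cst].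
Qed.

Lemma dotmx_covmx t v : 0 < t ->
  dotmx (covmx t *m v) v = (\int[mu]_(s in `[0%R, t]) dotmx (gram s *m v) v)%R.
Proof.
move=> t0; rewrite dotmxE; under [in RHS]eq_Rintegral do rewrite dotmxE.
rewrite Rintegral_sum; last first.
  by move=> i s; apply: cvgM; [exact: continuous_gram_mul|exact: cvg_cst].
apply: eq_bigr => i _; rewrite mxE RintegralZr//; last first.
  exact/integrable_continuous_itv/continuous_gram_mul.
congr (_ * _); under [in RHS]eq_Rintegral do rewrite mxE.
rewrite Rintegral_sum; last first.
  by move=> l s; apply: cvgM; [exact: continuous_gram|exact: cvg_cst].
apply: eq_bigr => l _; rewrite covmxE// RintegralZr//.
exact/integrable_continuous_itv/continuous_gram.
Qed.

Hypothesis psdQ : psdmx Q.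

Lemma psdmx_gram s : psdmx (gram s).
Proof.
split; first by rewrite /gram !trmx_mul !trmx_expmx trmxK psdQ.1 mulmxA.
move=> v; rewrite /gram -!mulmxA dotmxC dotmx_adj trmx_expmx dotmxC.
exact: psdQ.2.
Qed.

Lemma dotmx_gramD s t v :
  dotmx (gram (s + t) *m v) v = dotmx (gram t *m (expmx (s *: B^T) *m v)) (expmx (s *: B^T) *m v).
Proof.
rewrite [in RHS]dotmx_adj trmx_expmx trmxK /gram expmxD !mulmxA addrC expmxD.
by rewrite !mulmxA.
Qed.

Lemma psdmx_covmx t : 0 < t -> psdmx (covmx t).
Proof.
move=> t0; split.
  apply/matrixP => i j; rewrite mxE !covmxE//; apply: eq_Rintegral => s _.
  by rewrite -[in LHS](psdmx_gram s).1 mxE.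
move=> v; rewrite dotmx_covmx//; apply: Rintegral_ge0 => s _.
exact: (psdmx_gram s).2.
Qed.

Hypothesis unitK : forall t : R, 0 < t -> Kmx Q B t \in unitmx.

Lemma posdefmx_covmx t : 0 < t -> posdefmx (covmx t).
Proof.
move=> t0; apply: posdefmx_unit; first exact: psdmx_covmx.
by rewrite /covmx unitmxZ ?unitK// unitfE gt_eqF.
Qed.

(** Split the time integral at [s]; in the second part the flow up to time [s] factors out of the
    integrand. *)
Lemma dotmx_covmxD s t v : 0 < s -> 0 < t ->
  dotmx (covmx (s + t) *m v) v = dotmx (covmx s *m v) v +
    dotmx ((expmx (s *: B) *m covmx t *m expmx (s *: B^T)) *m v) v.
Proof.
move=> s0 t0; rewrite !dotmx_covmx ?addr_gt0//.
rewrite Rintegral_itv_cat ?ltW//; last exact: continuous_dotmx_gram.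
congr (_ + _); under eq_Rintegral do rewrite dotmx_gramD.
rewrite -dotmx_covmx// [LHS]dotmx_adj trmx_expmx trmxK.
by rewrite !mulmxA.
Qed.

(** The two forms differ by a conjugate of [covmx (t - s)], which is nonnegative. *)
Lemma le_det_covmx s t : 0 < s -> s <= t -> \det (covmx s) <= \det (covmx t).
Proof.
move=> s0; rewrite le_eqVlt => /predU1P[->//|st].
have ts0 : 0 < t - s by rewrite subr_gt0.
apply: le_det_posdefmx; [exact: posdefmx_covmx|apply: posdefmx_covmx; exact: lt_trans st|].
move=> v; rewrite -[t](subrK s) addrC dotmx_covmxD//= lerDl.
rewrite -!mulmxA dotmxC dotmx_adj trmx_expmx dotmxC.
exact: (psdmx_covmx _ ts0).2.
Qed.

Hypothesis trB : \tr B = 0.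

(** The two summands of [covmx (t + t)] have the same determinant since the flow of a traceless [B]
    preserves volume; this is the equality that [det_add_posdefmx] asks for. *)
Lemma det_covmx_double t : 0 < t -> 2 ^+ N * \det (covmx t) <= \det (covmx (t + t)).
Proof.
move=> t0; have dE : \det (expmx (t *: B)) = 1 by exact: det_expmx.
have dET : \det (expmx (t *: B^T)) = 1 by apply: det_expmx; rewrite mxtrace_tr.
apply: (det_add_posdefmx (covmx t) (expmx (t *: B) *m covmx t *m expmx (t *: B^T))).
- exact: posdefmx_covmx.
- rewrite -[expmx (t *: B)]trmxK trmx_expmx; apply: posdefmx_congr; last exact: posdefmx_covmx.
  by rewrite unitmxE dET unitr1.
- by apply: posdefmx_covmx; rewrite addr_gt0.
- by rewrite !det_mulmx dE dET mul1r mulr1.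
- by move=> v; rewrite dotmx_covmxD.
Qed.

(* The determinant is multiplied by at least [2 ^+ N] along [1, 2, 4, ...]. *)
Lemma det_covmx_ge (C : R) : (1 <= N)%N ->
  exists2 T, 0 < T & forall t, T <= t -> C <= \det (covmx t).
Proof.
move=> N1; pose c := \det (covmx 1).
have c0 : 0 < c by apply/posdefmx_det_gt0/posdefmx_covmx.
(* Growth like [2^k] is weakened to growth like [k], so that the Archimedean property yields the
   index. *)
have key k : k%:R * c <= \det (covmx (2 ^+ k)).
  apply: (@le_trans _ _ (2 ^+ k * c)).
    by rewrite ler_pM2r// -natrX ler_nat ltnW// ltn_expl.
  elim: k => [|k ih]; first by rewrite !expr0 mul1r.
  have p0 : 0 < 2 ^+ k :> R by rewrite exprn_gt0.
  have := det_covmx_double _ p0.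
  rewrite (_ : 2 ^+ k + 2 ^+ k = 2 ^+ k.+1); last by rewrite exprS mulr_natl mulr2n.
  apply: le_trans; rewrite exprS -mulrA.
  (* Here [N >= 1] enters: the factor [2 ^+ N] is at least 2. *)
  apply: (@le_trans _ _ (2 * \det (covmx (2 ^+ k)))); first by rewrite ler_pM2l.
  rewrite ler_wpM2r ?(le_trans _ ih) ?mulr_ge0 ?(ltW p0) ?(ltW c0)//.
  by rewrite -{1}[2]expr1 ler_weXn2l// ler1n.
pose k := (Num.truncn `|C / c|).+1.
exists (2 ^+ k) => [|t kt]; first by rewrite exprn_gt0.
apply: le_trans (le_det_covmx _ _ _ kt); last by rewrite exprn_gt0.
apply: le_trans (key k); rewrite -ler_pdivrMr//.
by rewrite (le_trans (ler_norm _))// ltW// truncnS_gt.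
Qed.

End covariance_matrix.

Section gaussian_kernel.
Context {R : realType} {N : nat} (Q B : 'M[R]_N).
Hypothesis psdQ : psdmx Q.
Hypothesis unitK : forall t : R, 0 < t -> Kmx Q B t \in unitmx.
Hypothesis trB : \tr B = 0.
Local Notation leb := (lebesgue_tuple R N).
Local Notation M := (covmx Q B).

Definition kernel_sup (t : R) : R :=
  (4 * pi) `^ (- (N%:R / 2)) / Num.sqrt (\det (M t)).

(** Since [K(t)^{-1} / (4 t) = (t K(t))^{-1} / 4], this is the matrix of the exponent, in the shape
    treated by [integral_gauss]. *)
Let S (t : R) : 'M[R]_N := 4^-1 *: invmx (M t).

Lemma kernel_pE (X Y : 'R[R]^N) (t : R) : 0 < t ->
  kernel_p Q B X Y t = kernel_sup t *
    expR (- dotmx (S t *m (colvec Y - expmx (t *: B) *m colvec X))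
                  (colvec Y - expmx (t *: B) *m colvec X)).
Proof.
move=> t0; rewrite /kernel_p /kernel_sup /S; congr (_ * expR (- _)).
have -> : invmx (M t) = t^-1 *: invmx (Kmx Q B t).
  by rewrite /covmx invmxZ// unitmxZ ?unitK// unitfE gt_eqF.
rewrite -!scalemxAl !dotmxZl.
by field; rewrite gt_eqF.
Qed.

Let posS t : 0 < t -> posdefmx (S t).
Proof.
by move=> t0; apply: posdefmxZ; [rewrite invr_gt0|exact/posdefmx_inv/posdefmx_covmx].
Qed.

Let detM t : 0 < t -> 0 < \det (M t).
Proof. by move=> t0; apply/posdefmx_det_gt0/posdefmx_covmx. Qed.

Lemma kernel_sup_gt0 t : 0 < t -> 0 < kernel_sup t.
Proof.
by move=> t0; rewrite divr_gt0 ?powR_gt0 ?mulr_gt0 ?pi_gt0// sqrtr_gt0 detM.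
Qed.

Lemma kernel_p_ge0 X Y t : 0 < t -> 0 <= kernel_p Q B X Y t.
Proof.
by move=> t0; rewrite kernel_pE// mulr_ge0 ?expR_ge0// ltW ?kernel_sup_gt0.
Qed.

Lemma kernel_p_le X Y t : 0 < t -> kernel_p Q B X Y t <= kernel_sup t.
Proof.
move=> t0; rewrite kernel_pE//; apply: ler_piMr; first by rewrite ltW// kernel_sup_gt0.
rewrite expR_le1 oppr_le0.
have [->|v0] := eqVneq (colvec Y - expmx (t *: B) *m colvec X) 0.
  by rewrite mulmx0 /dotmx mulmx0 mxE.
by rewrite ltW// (posS t t0).2.
Qed.

(** As [det (S t) = 4^{-N} / det (M t)], the Gaussian integral is [sqrt ((4 pi)^N det (M t))], the
    inverse of the peak value. *)
Let kernel_norm t : 0 < t ->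
  kernel_sup t * Num.sqrt (pi ^+ N / \det (S t)) = 1.
Proof.
move=> t0; rewrite /kernel_sup /S [\det (4^-1 *: _)]detZ det_inv exprVn.
have d0 := detM t t0.
rewrite !invfM !invrK mulrA -exprMn [pi * 4]mulrC.
have p4 : 0 <= 4 * pi :> R by rewrite mulr_ge0 ?pi_ge0.
rewrite sqrtrM ?exprn_ge0// powRN powRrM powR12_sqrt ?powR_ge0// powR_mulrn//.
have s1 : Num.sqrt ((4 * pi) ^+ N) != 0 :> R.
  by rewrite gt_eqF// sqrtr_gt0 exprn_gt0// mulr_gt0 ?pi_gt0.
have s2 : Num.sqrt (\det (M t)) != 0 by rewrite gt_eqF// sqrtr_gt0.
by rewrite mulrACA mulVf// mulVf// mulr1.
Qed.

Lemma integral_kernel_p_right X t : 0 < t ->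
  (\int[leb]_Y (kernel_p Q B X Y t)%:E = 1)%E.
Proof.
move=> t0; under eq_integral do rewrite kernel_pE// EFinM.
rewrite ge0_integralZl_EFin//.
- have [_ ->] := integral_gauss (S t) (expmx (t *: B) *m colvec X) (posS t t0).
  by rewrite -EFinM kernel_norm.
- exact: measurable_gauss.
- by rewrite ltW// kernel_sup_gt0.
Qed.

(* The backward flow has determinant 1, so the same Gaussian lemma applies in X. *)
Lemma integral_kernel_p_left Y t : 0 < t ->
  (\int[leb]_X (kernel_p Q B X Y t)%:E = 1)%E.
Proof.
move=> t0; pose E := expmx (t *: B).
have EF : E *m expmx ((- t) *: B) = 1%:M.
  by rewrite /E -expmxD subrr expmx_scale0.
have dE : \det E = 1 by exact: det_expmx.
have uE : E \in unitmx by rewrite unitmxE dE unitr1.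
pose S' := E^T *m S t *m E.
have dS' : \det S' = \det (S t) by rewrite /S' !det_mulmx det_tr dE mul1r mulr1.
have pS' : posdefmx S' by apply: posdefmx_congr => //; exact: posS.
pose m := expmx ((- t) *: B) *m colvec Y.
have H X : dotmx (S t *m (colvec Y - E *m colvec X)) (colvec Y - E *m colvec X) =
    dotmx (S' *m (colvec X - m)) (colvec X - m).
  have -> : colvec Y - E *m colvec X = - (E *m (colvec X - m)).
    by rewrite mulmxBr /m mulmxA EF mul1mx opprB.
  have dotmxNN (v w : 'cV[R]_N) : dotmx (- v) (- w) = dotmx v w.
    by rewrite !dotmxE; apply: eq_bigr => i _; rewrite !mxE mulrNN.
  rewrite mulmxN dotmxNN.
  by rewrite dotmx_adj /S' !mulmxA.
under eq_integral do rewrite kernel_pE// EFinM H.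
rewrite ge0_integralZl_EFin//.
- have [_ ->] := integral_gauss S' m pS'.
  by rewrite dS' -EFinM kernel_norm.
- exact: measurable_gauss.
- by rewrite ltW// kernel_sup_gt0.
Qed.

Lemma kernel_sup_small (e : R) : (1 <= N)%N -> 0 < e ->
  exists2 T, 0 < T & forall t, T <= t -> kernel_sup t <= e.
Proof.
move=> N1 e0; pose c : R := (4 * pi) `^ (- (N%:R / 2)).
have c0 : 0 < c by apply: powR_gt0; rewrite mulr_gt0 ?pi_gt0.
(* The peak is [c] divided by the root of the determinant, hence at most [e] once the determinant
   reaches [(c / e)^2]. *)
have [T T0 HT] := det_covmx_ge Q B psdQ unitK trB ((c / e) ^+ 2) N1.
exists T => // t Tt; have t0 : 0 < t := lt_le_trans T0 Tt.
rewrite /kernel_sup -/c ler_pdivrMr ?sqrtr_gt0 ?detM// mulrC -ler_pdivrMr//.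
have -> : c / e = Num.sqrt ((c / e) ^+ 2) by rewrite sqrtr_sqr ger0_norm// ltW// divr_gt0.
by rewrite ler_sqrt ?HT// ltW// detM.
Qed.

Lemma measurable_covmx : measurable_mx (`]0%R, +oo[%classic : set R) M.
Proof.
move=> i j.
apply: (eq_measurable_fun (fun t : R => \int[lebesgue_measure]_(s in `[0%R, t]) gram Q B s i j)%R).
  by move=> t /set_mem; rewrite /= in_itv/= andbT => t0; rewrite covmxE.
apply: open_continuous_measurable_fun; first exact: interval_open.
move=> t /set_mem; rewrite /= in_itv/= andbT => t0.
apply: Rintegral_itv0_continuous => //; exact: continuous_gram.
Qed.

(** Joint measurability is what the exchanges of integrals over [t], [X] and [Y] require. It is
    stated for [t > 0], where the covariance is invertible. *)
Lemma measurable_kernel_p :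
  measurable_fun (`]0%R, +oo[ `*` setT : set (R * ('R[R]^N * 'R[R]^N)))
    (fun z => kernel_p Q B z.2.1 z.2.2 z.1).
Proof.
set D := _ `*` _.
have mD : measurable D by exact: measurableX.
have D0 z : D z -> 0 < z.1 by move=> [/=]; rewrite in_itv/= andbT.
have mt : measurable_fun D (fst : R * ('R[R]^N * 'R[R]^N) -> R).
  exact: measurable_funTS.
have mM : measurable_mx D (fun z : R * ('R[R]^N * 'R[R]^N) => M z.1).
  move=> i j.
  have mi : measurable (`]0%R, +oo[%classic : set R) by exact: measurable_itv.
  have Di : fst @` D `<=` (`]0%R, +oo[%classic : set R) by move=> _ [z [? _] <-].
  exact: (measurable_comp mi Di (measurable_covmx i j) mt).
apply: (eq_measurable_fun (fun z => (4 * pi) `^ (- (N%:R / 2)) / Num.sqrt (\det (M z.1)) *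
    expR (- dotmx ((4^-1 *: invmx (M z.1)) *m (colvec z.2.2 - expmx (z.1 *: B) *m colvec z.2.1))
                  (colvec z.2.2 - expmx (z.1 *: B) *m colvec z.2.1)))).
  by move=> z /set_mem/D0 z0; rewrite kernel_pE.
have mX : measurable_mx D (fun z : R * ('R[R]^N * 'R[R]^N) => colvec z.2.1).
  move=> i j; apply: measurable_funTS.
  exact: (measurableT_comp (measurable_colvec i j) (measurableT_comp measurable_fst measurable_snd)).
have mY : measurable_mx D (fun z : R * ('R[R]^N * 'R[R]^N) => colvec z.2.2).
  move=> i j; apply: measurable_funTS.
  exact: (measurableT_comp (measurable_colvec i j) (measurableT_comp measurable_snd measurable_snd)).
have mE : measurable_mx D (fun z : R * ('R[R]^N * 'R[R]^N) => expmx (z.1 *: B)).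
  move=> i j; apply: (measurableT_comp (f := fun t : R => expmx (t *: B) i j)) => //.
  apply: continuous_measurable_fun; exact: continuous_expmx.
have mv : measurable_mx D (fun z : R * ('R[R]^N * 'R[R]^N) =>
    colvec z.2.2 - expmx (z.1 *: B) *m colvec z.2.1).
  by apply: measurable_mxB => //; exact: measurable_mx_mul.
apply: measurable_funM.
  apply: measurable_funM => //; apply: measurable_funV.
  apply: measurableT_comp; first exact: (continuous_measurable_fun (@sqrt_continuous R)).
  exact: measurable_det.
apply: measurableT_comp => //; apply: measurableT_comp => //.
apply: measurable_dotmx => //; apply: measurable_mx_mul => //.
move=> i j; under eq_fun do rewrite mxE.
apply: measurable_funM => //; apply: measurable_mx_inv => // z /D0 z0.
by rewrite unitmxE unitfE gt_eqF// detM.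
Qed.

End gaussian_kernel.

(** * Integrals with values in L1 *)

Section step_approximation.
Context {d d'} {U : measurableType d} {T : measurableType d'} {R : realType}.
Context (nu : {sigma_finite_measure set U -> \bar R})
        (mu : {sigma_finite_measure set T -> \bar R}).
Local Notation m := (nu \x mu)%E.

(** By Tonelli, an approximation in L1 of the product is an approximation of [u |-> h (u, _)] by
    L1-valued step functions in the integrated norm. *)
Definition step_approximable (h : U * T -> R) := forall e : R, 0 < e ->
  exists S : L1_step nu mu,
    (\int[m]_z `|(h z - step_fun S z.1 z.2)%:E| < e%:E)%E.

Lemma measurable_step_fun (S : L1_step nu mu) :
  measurable_fun setT (fun z : U * T => step_fun S z.1 z.2).
Proof.
apply: measurable_sum => i; apply: measurable_funM.
  have mi : measurable_fun setT (\1_(step_set i) : U -> R).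
    exact/measurable_indic/measurable_step_set.
  exact: (measurableT_comp mi measurable_fst).
have /Lfun1_integrable/(measurable_int mu)/measurable_EFinP mv := step_val_Lfun i.
exact: (measurableT_comp mv measurable_snd).
Qed.

Let step0 : exists S : L1_step nu mu, forall u x, step_fun S u x = 0.
Proof.
have abs (P : 'I_0 -> Prop) : forall i, P i by case.
exists (@L1Step _ _ _ _ _ nu mu 0 (fun=> set0) (fun=> cst 0) (abs _) (abs _) (abs _)).
by move=> u x; rewrite /step_fun big_ord0.
Qed.

Let stepD (S1 S2 : L1_step nu mu) : exists S : L1_step nu mu,
  forall u x, step_fun S u x = step_fun S1 u x + step_fun S2 u x.
Proof.
pose s (i : 'I_(step_size S1 + step_size S2)) : set U :=
  match fintype.split i with inl j => step_set j | inr j => step_set j end.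
pose v (i : 'I_(step_size S1 + step_size S2)) : T -> R :=
  match fintype.split i with inl j => step_val j | inr j => step_val j end.
have ms i : measurable (s i) by rewrite /s; case: fintype.split => j; exact: measurable_step_set.
have sy i : (nu (s i) < +oo)%E by rewrite /s; case: fintype.split => j; exact: step_set_lty.
have vL i : v i \in Lfun mu 1 by rewrite /v; case: fintype.split => j; exact: step_val_Lfun.
exists (L1Step ms sy vL) => u x; rewrite /step_fun/= big_split_ord/=; congr (_ + _).
  by apply: eq_bigr => i _; rewrite /s /v (unsplitK (inl _ i)).
by apply: eq_bigr => i _; rewrite /s /v (unsplitK (inr _ i)).
Qed.

Let stepZ (c : R) (S : L1_step nu mu) : exists S' : L1_step nu mu,
  forall u x, step_fun S' u x = c * step_fun S u x.
Proof.
have vL (i : 'I_(step_size S)) : c \*o step_val i \in Lfun mu 1.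
  have := step_val_Lfun i; move=> /Lfun1_integrable/(integrableZl measurableT c) H.
  exact/Lfun1_integrable.
exists (L1Step (@measurable_step_set _ _ _ _ _ _ _ S) (@step_set_lty _ _ _ _ _ _ _ S) vL) => u x.
by rewrite /step_fun/= mulr_sumr; apply: eq_bigr => i _; rewrite mulrCA.
Qed.

Let step_rect A B : measurable A -> measurable B -> (nu A < +oo)%E -> (mu B < +oo)%E ->
  exists S : L1_step nu mu, forall u x, step_fun S u x = \1_A u * \1_B x.
Proof.
move=> mA mB Ay By.
have BL : \1_B \in Lfun mu 1.
  apply/Lfun1_integrable/integrableP; split.
    by apply/measurable_EFinP; exact: measurable_indic.
  under eq_integral do rewrite /= ger0_norm//.
  by rewrite integral_indic// setIT.
exists (@L1Step _ _ _ _ _ nu mu 1 (fun=> A) (fun=> \1_B) (fun=> mA) (fun=> Ay) (fun=> BL)).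
by move=> u x; rewrite /step_fun big_ord1.
Qed.

Lemma measurable_step_dist (h : U * T -> R) (S : L1_step nu mu) :
  measurable_fun setT h ->
  measurable_fun setT (fun z => `|(h z - step_fun S z.1 z.2)%:E|%E).
Proof.
move=> mh; apply: measurableT_comp => //; apply/measurable_EFinP.
by apply: measurable_funB => //; exact: measurable_step_fun.
Qed.

Let approxD h1 h2 : measurable_fun setT h1 -> measurable_fun setT h2 ->
  step_approximable h1 -> step_approximable h2 -> step_approximable (h1 \+ h2).
Proof.
move=> m1 m2 a1 a2 e e0; have e2 : 0 < e / 2 by rewrite divr_gt0.
have [S1 S1e] := a1 _ e2; have [S2 S2e] := a2 _ e2; have [S SE] := stepD S1 S2.
exists S; rewrite [e]splitr EFinD; apply: le_lt_trans (lteD S1e S2e).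
have mB := measurable_step_dist.
rewrite -ge0_integralD//=; [|exact: mB..].
apply: ge0_le_integral => //=.
- by apply: (mB (h1 \+ h2)); exact: measurable_funD.
- by apply: emeasurable_funD; exact: mB.
- move=> z _; rewrite SE -EFinD lee_fin.
  by rewrite (_ : _ - _ = (h1 z - step_fun S1 z.1 z.2) + (h2 z - step_fun S2 z.1 z.2)) ?ler_normD//; ring.
Qed.

Let approxZ (c : R) h : measurable_fun setT h ->
  step_approximable h -> step_approximable (c \*o h).
Proof.
(* Adding 1 avoids a separate case for [c = 0]. *)
move=> mh ah e e0; have c0 : 0 < `|c| + 1 by rewrite ltr_wpDl.
have [S Se] := ah (e / (`|c| + 1)) (divr_gt0 e0 c0).
have [S' SE] := stepZ c S; exists S'.
have mB := measurable_step_dist h S mh.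
have -> : (\int[m]_z `|((c \*o h) z - step_fun S' z.1 z.2)%:E| =
    `|c|%:E * \int[m]_z `|(h z - step_fun S z.1 z.2)%:E|)%E.
  rewrite -ge0_integralZl_EFin//; apply: eq_integral => z _.
  by rewrite SE /= -mulrBr normrM EFinM.
apply: (@le_lt_trans _ _ ((`|c| + 1)%:E * \int[m]_z `|(h z - step_fun S z.1 z.2)%:E|)%E).
  by rewrite lee_wpmul2r ?integral_ge0// lee_fin lerDl.
by rewrite muleC -lte_pdivlMr// -EFinM.
Qed.

Let approx0 : step_approximable (cst 0).
Proof.
move=> e e0; have [S SE] := step0; exists S.
under eq_integral do rewrite SE subrr /= normr0.
by rewrite integral0 lte_fin.
Qed.

Let approx_sum {I : Type} (r : seq I) (h : I -> U * T -> R) :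
  (forall i, measurable_fun setT (h i)) -> (forall i, step_approximable (h i)) ->
  step_approximable (fun z => \sum_(i <- r) h i z).
Proof.
move=> mh ah; elim: r => [|i r ih].
  by rewrite (_ : (fun _ => _) = cst 0)//; apply/funext => z; rewrite big_nil.
rewrite (_ : (fun _ => _) = h i \+ (fun z => \sum_(i <- r) h i z)).
  by apply: approxD => //; exact: measurable_sum.
by apply/funext => z; rewrite big_cons.
Qed.

Let approx_lim (h : U * T -> R) : measurable_fun setT h ->
  (forall e : R, 0 < e -> exists h', [/\ measurable_fun setT h', step_approximable h' &
     (\int[m]_z `|(h z - h' z)%:E| < e%:E)%E]) ->
  step_approximable h.
Proof.
move=> mh H e e0; have e2 : 0 < e / 2 by rewrite divr_gt0.
have [h' [mh' ah' he]] := H _ e2; have [S Se] := ah' _ e2.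
exists S; rewrite [e]splitr EFinD; apply: le_lt_trans (lteD he Se).
have mB1 : measurable_fun setT (fun z => `|(h z - h' z)%:E|%E).
  by apply: measurableT_comp => //; apply/measurable_EFinP; exact: measurable_funB.
have mB2 := measurable_step_dist.
rewrite -ge0_integralD//=; last exact: mB2.
apply: ge0_le_integral => //=; first exact: mB2.
- by apply: emeasurable_funD => //; exact: mB2.
- by move=> z _; rewrite -EFinD lee_fin ler_distD.
Qed.

(** Continuity of the measure from below: some [E n] misses the union by less than [e], and the
    indicators then differ by less than [e] in L1. *)
Let approx_indic_cup (E : (set (U * T))^nat) : (forall n, measurable (E n)) ->
  nondecreasing_seq E -> (m (\bigcup_n E n) < +oo)%E ->
  (forall n, step_approximable \1_(E n)) -> step_approximable \1_(\bigcup_n E n).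
Proof.
move=> mE ndE finE aE; have mcE : measurable (\bigcup_n E n) by exact: bigcup_measurable.
apply: approx_lim; first exact: measurable_indic.
move=> e e0.
have := nondecreasing_cvg_mu (mu := m) mE mcE ndE.
have fE : m (\bigcup_n E n) \is a fin_num by rewrite ge0_fin_numE.
rewrite -[X in _ --> X](fineK fE) => /fine_cvgP[_ /cvgrPdist_lt/(_ _ e0)[n _ /(_ n (leqnn n)) /= ne]].
have En : E n `<=` \bigcup_n E n by exact: bigcup_sup.
have fEn : (m (E n) < +oo)%E.
  by apply: le_lt_trans finE; apply: le_measure; [exact/mem_set|exact/mem_set|].
exists \1_(E n); split => //.
have -> : (\int[m]_z `|(\1_(\bigcup_n E n) z - \1_(E n) z)%:E| =
    \int[m]_z (\1_(\bigcup_n E n `\` E n) z)%:E)%E.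
  apply: eq_integral => z _; rewrite !indicE in_setD.
  have [zE|zE]/= := boolP (z \in E n); last by rewrite subr0 andbT ger0_norm.
  by rewrite (mem_set (En _ (set_mem zE))) subrr normr0.
rewrite integral_indic//; last exact: measurableD.
rewrite setIT measureD//= setIidr//.
move: ne; rewrite -lte_fin; apply: le_lt_trans.
rewrite -(fineK fE) -(@fineK _ (m (E n))) ?ge0_fin_numE//.
by rewrite -EFinB lee_fin ler_norm.
Qed.

Let approx_rect A B : measurable A -> measurable B -> (nu A < +oo)%E -> (mu B < +oo)%E ->
  step_approximable \1_(A `*` B).
Proof.
move=> mA mB Ay By e e0; have [S SE] := step_rect A B mA mB Ay By; exists S.
rewrite (eq_integral (cst 0%E)) ?integral0 ?lte_fin// => -[u x] _.
by rewrite SE /= !indicE in_setX -natrM mulnb subrr normr0.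
Qed.

(** Dynkin's argument, starting from rectangles, which are stable under intersection and generate
    the product sigma-algebra. Intersecting with a box of finite measure keeps complements
    integrable: the complement becomes a difference of two approximable indicators. *)
Let approx_indic_box A B E : measurable A -> measurable B ->
  (nu A < +oo)%E -> (mu B < +oo)%E -> measurable E ->
  step_approximable \1_(E `&` (A `*` B)).
Proof.
move=> mA mB Ay By mE.
have mW : measurable (A `*` B) by exact: measurableX.
have Wy : (m (A `*` B) < +oo)%E by rewrite product_measure1E// lte_mul_pinfty// ge0_fin_numE.
pose G := [set C | exists A' B', [/\ measurable A', measurable B' & C = A' `*` B' :> set (U * T)]].
have GE : @measurable _ (U * T)%type = <<s G >>.
  rewrite measurable_prod_measurableType; congr (<<s _ >>); apply/seteqP; split => C /=.
    by move=> [A' mA' [B' mB' <-]]; exists A', B'.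
  by move=> [A' [B' [mA' mB' ->]]]; exists A' => //; exists B'.
rewrite GE in mE; move: E mE; apply: (dynkin_induction GE).
- move=> _ _ [A1 [B1 [mA1 mB1 ->]]] [A2 [B2 [mA2 mB2 ->]]].
  by exists (A1 `&` A2), (B1 `&` B2); split; [exact: measurableI|exact: measurableI|rewrite setXI].
- by rewrite setTI; exact: approx_rect.
- move=> _ [A' [B' [mA' mB' ->]]]; rewrite -setXI; apply: approx_rect.
  + exact: measurableI.
  + exact: measurableI.
  + apply: le_lt_trans Ay; apply: le_measure;
      [exact/mem_set/measurableI|exact/mem_set|exact: subIsetr].
  + apply: le_lt_trans By; apply: le_measure;
      [exact/mem_set/measurableI|exact/mem_set|exact: subIsetr].
- move=> S mS aS.
  rewrite (_ : \1_(~` S `&` A `*` B) = \1_(A `*` B) \+ (-1) \*o \1_(S `&` A `*` B)).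
    apply: approxD; [exact: measurable_indic| |exact: approx_rect|].
      by apply: measurable_funM => //; apply: measurable_indic; exact: measurableI.
    by apply: approxZ => //; apply: measurable_indic; exact: measurableI.
  apply/funext => z /=; rewrite !indicE !in_setI in_setC.
  by case: (z \in S) => /=; case: (_ && _) => /=; ring.
- move=> F mF tF aF; rewrite setI_bigcupl.
  pose E n := \big[setU/set0]_(k < n) (F k `&` A `*` B).
  have mFW n : measurable (F n `&` A `*` B) by exact: measurableI.
  have mE n : measurable (E n) by exact: bigsetU_measurable.
  have EE : \bigcup_n E n = \bigcup_k (F k `&` A `*` B).
    apply/seteqP; split => z [n _]; rewrite /E.
      by rewrite -(bigcup_mkord n (fun k => F k `&` A `*` B)) => -[k _ ?]; exists k.
    move=> ?; exists n.+1 => //.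
    by rewrite -(bigcup_mkord n.+1 (fun k => F k `&` A `*` B)); exists n => /=.
  rewrite -EE; apply: approx_indic_cup => //.
  + move=> i j ij; apply/subsetPset.
    exact: (@subset_bigsetU _ (fun k => F k `&` A `*` B) i j ij).
  + rewrite EE; apply: le_lt_trans Wy; apply: le_measure;
      [apply/mem_set; exact: bigcup_measurable|exact/mem_set|].
    by apply: bigcup_sub => k _; exact: subIsetr.
  + elim => [|n ih]; first by rewrite /E big_ord0 indic0.
    rewrite (_ : \1_(E n.+1) = \1_(E n) \+ \1_(F n `&` A `*` B)).
      by apply: approxD => //; exact: measurable_indic.
    apply/funext => z /=; rewrite /E big_ord_recr/= -/(E n) !indicE in_setU.
    have [zF|zF] := boolP (z \in F n `&` A `*` B); last by rewrite orbF addr0.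
    rewrite orbT (_ : (z \in E n) = false) ?add0r//.
    apply/negbTE/negP => /set_mem.
    rewrite /E -(bigcup_mkord n (fun k => F k `&` A `*` B)) => -[k /= kn [zk _]].
    have /trivIsetP/(_ k n Logic.I Logic.I) := tF.
    rewrite lt_eqF// => /(_ isT) /seteqP[/(_ z)+ _]; apply.
    by split => //; case: (set_mem zF).
Qed.

Let approx_indic E : measurable E -> (m E < +oo)%E -> step_approximable \1_E.
Proof.
move=> mE Ey.
have /sigma_finiteP[A [AT ndA Ay]] := sigma_finiteT nu.
have /sigma_finiteP[B [BT ndB By]] := sigma_finiteT mu.
pose W n := E `&` (A n `*` B n).
have WE : E = \bigcup_n W n.
  apply/seteqP; split => [[u x] Eux|z [n _ []//]].
  have [i _ Ai] : (\bigcup_k A k) u by rewrite -AT.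
  have [j _ Bj] : (\bigcup_k B k) x by rewrite -BT.
  (* The two exhaustions are nondecreasing, so one index serves both coordinates. *)
  exists (maxn i j) => //; split => //; split => /=.
  - by move: Ai; apply/subsetPset/ndA/leq_maxl.
  - by move: Bj; apply/subsetPset/ndB/leq_maxr.
rewrite WE; apply: approx_indic_cup.
- by move=> n; apply: measurableI => //; apply: measurableX; [have [] := Ay n|have [] := By n].
- move=> i j ij; apply/subsetPset; apply: setIS => -[u x] [/= Au Bx]; split => /=.
    by move: Au; apply/subsetPset/ndA.
  by move: Bx; apply/subsetPset/ndB.
- by rewrite -WE.
- move=> n; have [? ?] := Ay n; have [? ?] := By n; exact: approx_indic_box.
Qed.

Import HBSimple.

Lemma step_approximable_integrable (h : U * T -> R) :
  m.-integrable setT (EFin \o h) -> step_approximable h.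
Proof.
move=> ih; have mh : measurable_fun setT h by apply/measurable_EFinP; exact: (measurable_int m).
apply: approx_lim => // e e0.
have [g [ig _ gh]] := approximation_sfun_integrable measurableT ih.
have [n _ /(_ n (leqnn n)) /= gn] : \forall n \near \oo,
    (\int[m]_z `|(EFin \o h) z - (g n z)%:E| < e%:E)%E.
  by apply: (gh [set y | (y < e%:E)%E]); apply: open_ereal_lt'; rewrite lte_fin.
exists (g n); split => //.
rewrite (funext (fimfunEord (g n))); set s := fset_set _.
apply: approx_sum => i; move: (_`_i) => k.
  by apply: measurable_funM => //; exact: measurable_indic.
(* The value 0 is set apart, since its level set may have infinite measure; the other level sets are
   finite by Markov's inequality. *)
have [->|k0] := eqVneq k 0.
  by rewrite (_ : (fun _ => _) = cst 0)//; apply/funext => z; rewrite mul0r.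
apply: approxZ; first exact: measurable_indic.
apply: approx_indic => //.
have k0' : 0 < `|k| by rewrite normr_gt0.
have /integrableP[_ iy] := ig n.
have : (`|k|%:E * m (g n @^-1` [set k]) < +oo)%E.
  apply: le_lt_trans iy; rewrite -[g n @^-1` [set k]]setIT -integral_indic//.
  rewrite -ge0_integralZl_EFin//; last by apply/measurable_EFinP/measurable_indic.
  apply: ge0_le_integral => //.
  - by apply/measurable_EFinP; apply: measurable_funM => //; exact: measurable_indic.
  - by apply: measurableT_comp => //; apply/measurable_EFinP.
  - move=> z _; rewrite /= -EFinM lee_fin indicE.
    by have [/set_mem/= ->|_] := boolP (z \in _); rewrite ?mulr1// mulr0.
case: (m _) (measure_ge0 m (g n @^-1` [set k])) => [r|_|]//.
  by rewrite !ltry.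
by rewrite gt0_muley ?lte_fin.
Qed.

End step_approximation.

Section L1_distance.
Context {d} {T : measurableType d} {R : realType} (mu : {measure set T -> \bar R}).
Implicit Types f g h : T -> R.

Lemma L1_distE f g : L1_dist mu f g = (\int[mu]_x `|(f x - g x)%:E|)%E.
Proof. by rewrite /L1_dist Lnorm1. Qed.

Lemma L1_dist_ge0 f g : (0 <= L1_dist mu f g)%E.
Proof. by rewrite L1_distE integral_ge0. Qed.

Lemma L1_distC f g : L1_dist mu f g = L1_dist mu g f.
Proof. by rewrite !L1_distE; apply: eq_integral => x _; rewrite /= distrC. Qed.

Lemma measurable_EFin_dist f g : measurable_fun setT f -> measurable_fun setT g ->
  measurable_fun setT (fun x => `|(f x - g x)%:E|%E).
Proof.
by move=> mf mg; apply: measurableT_comp => //; apply/measurable_EFinP; exact: measurable_funB.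
Qed.

Lemma L1_dist_triangle f g h : measurable_fun setT f -> measurable_fun setT g ->
  measurable_fun setT h -> (L1_dist mu f h <= L1_dist mu f g + L1_dist mu g h)%E.
Proof.
move=> mf mg mh; rewrite !L1_distE.
rewrite -ge0_integralD//=; [|exact: measurable_EFin_dist..].
apply: ge0_le_integral => //=; first exact: measurable_EFin_dist.
  by apply: emeasurable_funD; exact: measurable_EFin_dist.
by move=> x _; rewrite -EFinD lee_fin ler_distD.
Qed.

Lemma Lnorm1_L1_dist f : 'N[mu]_1[EFin \o f]%E = L1_dist mu f (cst 0).
Proof. by rewrite L1_distE Lnorm1; apply: eq_integral => x _; rewrite /= subr0. Qed.

Lemma Lnorm1_eq_L1_dist f g : measurable_fun setT f -> measurable_fun setT g ->
  L1_dist mu f g = 0%E -> 'N[mu]_1[EFin \o f]%E = 'N[mu]_1[EFin \o g]%E.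
Proof.
move=> mf mg fg0; rewrite !Lnorm1_L1_dist; apply/eqP; rewrite eq_le; apply/andP; split.
  by have := L1_dist_triangle f g (cst 0) mf mg (measurable_cst _); rewrite fg0 add0e.
by have := L1_dist_triangle g f (cst 0) mg mf (measurable_cst _); rewrite (L1_distC g f) fg0 add0e.
Qed.

Lemma Lfun1_measurable f : f \in Lfun mu 1 -> measurable_fun setT f.
Proof. by move=> /Lfun1_integrable/(measurable_int mu)/measurable_EFinP. Qed.

End L1_distance.

(** * The Bochner integral as a pointwise integral *)

Section L1_integral_pointwise.
Context {d d'} {U : measurableType d} {T : measurableType d'} {R : realType}.
Context (nu : {sigma_finite_measure set U -> \bar R})
        (mu : {sigma_finite_measure set T -> \bar R}).
Local Notation m := (nu \x mu)%E.
Context (D : set U) (F : U -> T -> R).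
Hypothesis mD : measurable D.
Hypothesis mF : measurable_fun (D `*` setT) (fun z => F z.1 z.2).
Hypothesis FL : forall u, D u -> F u \in Lfun mu 1.
Hypothesis iF : (\int[nu]_(u in D) \int[mu]_x `|(F u x)%:E| < +oo)%E.

(** Extension by zero in time, so that Fubini's theorem can be used on the whole product. *)
Let H : U * T -> R := (fun z => F z.1 z.2) \_ (D `*` setT).

Let HE u x : D u -> H (u, x) = F u x.
Proof. by move=> Du; rewrite /H patchE mem_set. Qed.

Let H0 u x : ~ D u -> H (u, x) = 0.
Proof. by move=> Du; rewrite /H patchE memNset// => -[]. Qed.

Let mH : measurable_fun setT H.
Proof. by apply/(measurable_restrictT _ _).1 => //; exact: measurableX. Qed.

Let iH : m.-integrable setT (EFin \o H).
Proof.
apply/integrable12ltyP; first exact/measurable_EFinP.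
move: iF; rewrite [X in (X < _)%E -> _]integral_mkcond; apply: le_lt_trans.
rewrite le_eqVlt; apply/orP; left; apply/eqP; apply: eq_integral => u _.
rewrite patchE; case: ifPn => [/set_mem Du|/negP uD].
  by apply: eq_integral => x _; rewrite /= HE.
by rewrite (eq_integral (cst 0%E)) ?integral0// => x _; rewrite /= H0 ?normr0// => /mem_set.
Qed.

(** At almost every [x] the integrand is integrable; at the remaining points [Rintegral] returns a
    default value, which does not affect the L1 class. *)
Definition pointwise_integral (x : T) : R := (\int[nu]_(u in D) F u x)%R.
Local Notation G := pointwise_integral.

Let GE x : G x = fine (\int[nu]_u (H (u, x))%:E)%E.
Proof.
rewrite /G /Rintegral integral_mkcond; congr fine; apply: eq_integral => u _.
rewrite patchE; case: ifPn => [/set_mem Du|/negP uD]; first by rewrite HE.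
by rewrite H0// => /mem_set.
Qed.

Let mG : measurable_fun setT G.
Proof.
rewrite (_ : G = fun x => fine (\int[nu]_u (H (u, x))%:E)%E); last by apply/funext.
by apply: measurableT_comp => //; exact: (measurable_fubini_G iH).
Qed.

Let abs_fine_le (e : \bar R) : (`|(fine e)%:E| <= `|e|)%E.
Proof. by case: e => [r| |] //=; rewrite ?normr0 ?leey. Qed.

Let mHx x : measurable_fun setT (fun u => H (u, x)).
Proof. exact: (measurableT_comp mH (pair2_measurable x)). Qed.

Let GL : G \in Lfun mu 1.
Proof.
apply/Lfun1_integrable/integrableP; split; first exact/measurable_EFinP.
have mEH : measurable_fun setT (EFin \o H) by exact/measurable_EFinP.
have := (integrable21ltyP nu mu mEH).1 iH.
apply: le_lt_trans; apply: ge0_le_integral => //=.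
- by apply/measurable_EFinP; exact: measurableT_comp.
- apply: (measurable_fun_fubini_tonelli_G (fun z => (`|H z|)%:E)) => //.
  by apply/measurable_EFinP; exact: measurableT_comp.
- move=> x _; rewrite GE; apply: le_trans (abs_fine_le _) _.
  by apply: le_abse_integral => //; exact/measurable_EFinP.
Qed.

Let msd (S : L1_step nu mu) : measurable_fun setT (fun z => `|(H z - step_fun S z.1 z.2)%:E|%E).
Proof. exact: measurable_step_dist. Qed.

Let dist_stepE (S : L1_step nu mu) u : D u ->
  L1_dist mu (F u) (step_fun S u) = (\int[mu]_x `|(H (u, x) - step_fun S u x)%:E|)%E.
Proof. by move=> Du; rewrite L1_distE; apply: eq_integral => x _; rewrite HE. Qed.

Let measurable_dist_step (S : L1_step nu mu) :
  measurable_fun D (fun u => L1_dist mu (F u) (step_fun S u)).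
Proof.
apply: (eq_measurable_fun (fun u => \int[mu]_x `|(H (u, x) - step_fun S u x)%:E|)%E).
  by move=> u /set_mem Du; rewrite dist_stepE.
apply: measurable_funTS.
exact: (measurable_fun_fubini_tonelli_F _ (msd S)).
Qed.

Let integral_dist_step_le (S : L1_step nu mu) :
  (\int[nu]_(u in D) L1_dist mu (F u) (step_fun S u) <=
   \int[m]_z `|(H z - step_fun S z.1 z.2)%:E|)%E.
Proof.
rewrite (fubini_tonelli1 _ (msd S))//= /fubini_F.
rewrite (eq_integral (fun u => \int[mu]_x `|(H (u, x) - step_fun S u x)%:E|)%E); last first.
  by move=> u /set_mem Du; rewrite dist_stepE.
apply: ge0_subset_integral => //; first exact: (measurable_fun_fubini_tonelli_F _ (msd S)).
by move=> u _; exact: integral_ge0.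
Qed.

Let step_integralE (S : L1_step nu mu) x :
  nu.-integrable D (fun u => (step_fun S u x)%:E) /\
  step_integral D S x = (\int[nu]_(u in D) step_fun S u x)%R.
Proof.
have fin i : (nu (D `&` @step_set _ _ _ _ _ _ _ S i) < +oo)%E.
  apply: le_lt_trans (step_set_lty i); apply: le_measure;
    [|exact/mem_set/measurable_step_set|exact: subIsetr].
  by apply/mem_set; apply: measurableI => //; exact: measurable_step_set.
have ind i : nu.-integrable D (fun u => (\1_(@step_set _ _ _ _ _ _ _ S i) u)%:E).
  apply/integrableP; split.
    by apply/measurable_EFinP; apply: measurable_indic; exact: measurable_step_set.
  under eq_integral do rewrite /= ger0_norm//.
  have mS : measurable (@step_set _ _ _ _ _ _ _ S i) by exact: measurable_step_set.
  by rewrite (integral_indic nu mD mS) setIC; exact: fin.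
have indv i : nu.-integrable D (fun u => (\1_(@step_set _ _ _ _ _ _ _ S i) u * step_val i x)%:E).
  have := integrableZl mD (step_val i x) (ind i).
  by apply: eq_integrable => // u _; rewrite -EFinM mulrC.
have stepE u : (step_fun S u x)%:E = (\sum_(i < step_size S) (\1_(step_set i) u * step_val i x)%:E)%E.
  by rewrite /step_fun sumEFin.
split; first by under eq_fun do rewrite stepE; exact: integrable_sum.
rewrite /Rintegral; under [in RHS]eq_integral do rewrite stepE.
rewrite integral_sum//.
rewrite (eq_bigr (fun i => (fine (nu (D `&` step_set i)) * step_val i x)%:E)); last first.
  move=> i _; under eq_integral do rewrite mulrC EFinM.
  have mS : measurable (@step_set _ _ _ _ _ _ _ S i) by exact: measurable_step_set.
  rewrite integralZl// (integral_indic nu mD mS).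
  by rewrite EFinM fineK ?ge0_fin_numE ?fin// setIC muleC.
by rewrite sumEFin.
Qed.

(** The triangle inequality for integrals at almost every [x], followed by Tonelli. Both existence
    and uniqueness of the Bochner integral rest on this estimate. *)
Let dist_step_integral_le (S : L1_step nu mu) :
  (L1_dist mu (step_integral D S) G <=
   \int[nu]_(u in D) L1_dist mu (F u) (step_fun S u))%E.
Proof.
have mS : measurable_fun setT (step_integral D S).
  apply: measurable_sum => i; apply: measurable_funM => //.
  exact: (Lfun1_measurable mu _ (step_val_Lfun i)).
pose K z := (`|(H z - step_fun S z.1 z.2)%:E| * (\1_D z.1)%:E)%E.
have mK : measurable_fun setT K.
  apply: emeasurable_funM => //; apply/measurable_EFinP.
  exact: (measurableT_comp (measurable_indic mD) measurable_fst).
have K0 z : (0 <= K z)%E by rewrite /K mule_ge0// lee_fin.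
rewrite (_ : (\int[nu]_(u in D) _ = \int[nu]_u \int[mu]_x K (u, x))%E); last first.
  rewrite integral_mkcond; apply: eq_integral => u _; rewrite patchE /K /= indicE.
  case: ifPn => [/set_mem Du|uD].
    by rewrite dist_stepE//; apply: eq_integral => x _; rewrite mule1.
  by rewrite (eq_integral (cst 0%E)) ?integral0// => x _; rewrite mule0.
rewrite (fubini_tonelli K mK K0)// L1_distE.
apply: ae_ge0_le_integral => //=.
- exact: measurable_EFin_dist.
- by move=> x _; exact: integral_ge0.
- exact: (measurable_fun_fubini_tonelli_G _ mK).
have := ae_integrable2 iH; apply: filterS => x ix _.
have [iS ->] := step_integralE S x.
have ixD : nu.-integrable D (fun u => (F u x)%:E).
  apply: (eq_integrable mD (fun u => (H (u, x))%:E)).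
    by move=> u /set_mem Du; rewrite HE.
  exact: integrableS ix.
rewrite /G -RintegralB// EFin_normr_Rintegral//; last first.
  exact: (integrableB mD iS ixD).
have := @le_abse_integral _ _ _ nu D (fun u => (step_fun S u x - F u x)%:E) mD.
have mSF : measurable_fun D (fun u => (step_fun S u x - F u x)%:E).
  exact: (measurable_int nu (integrableB mD iS ixD)).
move=> /(_ mSF) /le_trans; apply.
rewrite integral_mkcond le_eqVlt; apply/orP; left; apply/eqP; apply: eq_integral => u _.
rewrite patchE /K /= indicE; case: ifPn => [/set_mem Du|uD]; last by rewrite mule0.
by rewrite mule1 HE// distrC.
Qed.

Lemma is_L1_integral_pointwise : is_L1_integral nu mu D F G.
Proof.
split => //.
have inv0 k : 0 < k.+1%:R^-1 :> R by rewrite invr_gt0.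
have /choice[S HS] : forall k, exists S : L1_step nu mu,
    (\int[m]_z `|(H z - step_fun S z.1 z.2)%:E| < (k.+1%:R^-1)%:E)%E.
  by move=> k; exact: (step_approximable_integrable nu mu H iH _ (inv0 k)).
have cvg0 : (k.+1%:R^-1)%:E @[k --> \oo] --> (0 : \bar R)%E.
  by apply: cvg_EFin; [exact: nearW|exact: cvg_harmonic].
have le1 k : (\int[nu]_(u in D) L1_dist mu (F u) (step_fun (S k) u) <= (k.+1%:R^-1)%:E)%E.
  by apply: le_trans (integral_dist_step_le _) _; exact: ltW.
exists S; split => //.
  apply: (squeeze_cvge _ (cvg_cst 0%E) cvg0); apply: nearW => k; rewrite le1 andbT.
  by apply: integral_ge0 => u _; exact: L1_dist_ge0.
apply: (squeeze_cvge _ (cvg_cst 0%E) cvg0); apply: nearW => k.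
rewrite L1_dist_ge0/=; exact: le_trans (dist_step_integral_le _) (le1 k).
Qed.

(** The step integrals that converge to [g] also converge to the pointwise integral, by
    [dist_step_integral_le]. *)
Lemma is_L1_integral_unique g : is_L1_integral nu mu D F g -> L1_dist mu G g = 0%E.
Proof.
move=> [_ gL [S [_ FS Sg]]].
have mg := Lfun1_measurable mu g gL.
have mS k : measurable_fun setT (step_integral D (S k)).
  apply: measurable_sum => i; apply: measurable_funM => //.
  exact: (Lfun1_measurable mu _ (step_val_Lfun i)).
apply/eqP; rewrite eq_le L1_dist_ge0 andbT.
have cvgS : (\int[nu]_(u in D) L1_dist mu (F u) (step_fun (S k) u) +
    L1_dist mu (step_integral D (S k)) g)%E @[k --> \oo] --> (0 + 0)%E.
  exact: cvgeD.
rewrite adde0 in cvgS; apply: (cvge_ge _ cvgS); apply: nearW => k.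
apply: le_trans (L1_dist_triangle mu _ _ _ mG (mS k) mg) _.
by rewrite leeD2r// L1_distC dist_step_integral_le.
Qed.

(** Existence ensures that the choice made by [xget] is a genuine integral and not the default 0;
    uniqueness then makes its norm independent of the choice. The constant [c] stands for the
    prefactor of [frac_power]. *)
Lemma Lnorm1_L1_integral (c : R) :
  'N[mu]_1[EFin \o (fun x => c * L1_integral nu mu D F x)%R]%E =
  'N[mu]_1[EFin \o (fun x => c * G x)%R]%E.
Proof.
have is_int : is_L1_integral nu mu D F (L1_integral nu mu D F).
  exact: (@xgetPex _ (cst 0) [set g | is_L1_integral nu mu D F g] (ex_intro _ G is_L1_integral_pointwise)).
have mg : measurable_fun setT (L1_integral nu mu D F).
  by have [_ /Lfun1_measurable] := is_int.
have d0 := is_L1_integral_unique _ is_int.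
apply: Lnorm1_eq_L1_dist; [exact: measurable_funM|exact: measurable_funM|].
rewrite L1_distE.
under eq_integral do rewrite -mulrBr EFinM abseM.
rewrite ge0_integralZl//=.
  by rewrite -L1_distE L1_distC d0 mule0.
exact: measurable_EFin_dist.
Qed.

End L1_integral_pointwise.

(** * Limit of the Gamma function at 1 *)

Section power_integrals.
Context {R : realType}.
Local Notation mu := (@lebesgue_measure R).

Lemma integral_powR_tail (s T : R) : 0 < s -> 0 < T ->
  (\int[mu]_(t in `[T, +oo[) ((t `^ (1 + s))^-1)%:E = (s^-1 * T `^ (- s))%:E)%E.
Proof.
move=> s0 T0; pose F (t : R) := - s^-1 * t `^ (- s).
have dF (t : R) : 0 < t -> is_derive t 1 F ((t `^ (1 + s))^-1).
  move=> t0.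
  have -> : (t `^ (1 + s))^-1 = - s^-1 *: (- s * t `^ (- s - 1)).
    rewrite /GRing.scale/= mulrA mulrNN mulVf ?gt_eqF// mul1r -powRN; congr (_ `^ _).
    by rewrite opprD addrC.
  exact: (is_deriveZ _ (is_derive1_powR _ t0)).
rewrite (@ge0_continuous_FTC2y _ _ F _ 0).
- by rewrite add0e /F -EFinN mulNr opprK.
- by move=> x _; rewrite invr_ge0 powR_ge0.
- apply: derivable_within_continuous => x; rewrite in_itv/= andbT => Tx.
  have x0 : 0 < x := lt_le_trans T0 Tx.
  apply: derivableV; first by rewrite gt_eqF// powR_gt0.
  by apply: derivable_powR; rewrite in_itv/= x0.
- rewrite -(mulr0 (- s^-1)) /F; apply: cvgMl_tmp.
  apply/cvgrPdist_lt => e e0; near=> x.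
  have x1 : 0 < x by near: x; exact: nbhs_pinfty_gt.
  (* The point at which [x^{-s}] equals [e]. *)
  have x2 : expR (s^-1 * - ln e) < x.
    by near: x; apply: nbhs_pinfty_gt; rewrite num_real.
  rewrite sub0r normrN ger0_norm ?powR_ge0// /powR gt_eqF//.
  rewrite -[ltRHS]lnK ?posrE// ltr_expR mulNr ltrNl -ltr_pdivrMl//.
  by rewrite -[ltLHS]expRK ltr_ln ?posrE ?expR_gt0.

- by move=> x Tx; have [] := dF x (lt_trans T0 Tx).
- apply: cvg_at_right_filter.
  have [d _] := dF T T0; exact/differentiable_continuous/derivable1_diffP.
- move=> x; rewrite in_itv/= andbT => Tx; rewrite derive1E.
  by have [_ ->] := dF x (lt_trans T0 Tx).
Unshelve. all: by end_near. Qed.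

(** The integrand is singular at 0, so the primitive [2 sqrt t] is used on [[1/(i+1), 1]] and
    monotone convergence does the rest. *)
Lemma integral_rsqrt_le2 : (\int[mu]_(t in `]0%R, 1%R]) ((t `^ 2^-1)^-1)%:E <= 2%:E)%E.
Proof.
pose F (i : nat) : set R := `[i.+1%:R^-1, 1]%classic.
have FE : `]0%R, 1%R]%classic = \bigcup_i F i :> set R.
  apply/seteqP; split => [x|x [i _]]; rewrite /F /= !in_itv/=.
    move=> /andP[x0 x1]; exists (Num.truncn x^-1) => //=; rewrite in_itv/= x1 andbT.
    by rewrite invf_ple ?posrE// ltW// truncnS_gt.
  by move=> /andP[ix ->]; rewrite andbT (lt_le_trans _ ix)// invr_gt0.
have mf : measurable_fun setT (fun t : R => ((t `^ 2^-1)^-1)%:E).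
  apply/measurable_EFinP.
  have -> : (fun t : R => (t `^ 2^-1)^-1) = fun t => t `^ (- 2^-1).
    by apply/funext => t; rewrite powRN.
  exact: measurable_powR.
have ndF : nondecreasing_seq F.
  move=> i j ij; apply/subsetPset => x; rewrite /F /= !in_itv/= => /andP[ix ->].
  by rewrite andbT (le_trans _ ix)// lef_pV2 ?posrE// ler_nat.
have Fle i : (\int[mu]_(t in F i) ((t `^ 2^-1)^-1)%:E <= 2%:E)%E.
  (* For [i = 0] the interval is a single point, whereas the fundamental theorem of calculus wants
     distinct endpoints. *)
  have [i1|i1] := ltP (i.+1%:R^-1 : R) 1; last first.
    rewrite /F; move: i1; rewrite le_eqVlt => /predU1P[<-|i1].
      by rewrite set_itv1 integral_set1.
    by rewrite set_itv_ge ?integral_set0// bnd_simp -ltNge.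
  have a0 : 0 < i.+1%:R^-1 :> R by rewrite invr_gt0.
  pose G (t : R) := 2 * t `^ 2^-1.
  have dG (t : R) : 0 < t -> is_derive t 1 G ((t `^ 2^-1)^-1).
    move=> t0; have -> : (t `^ 2^-1)^-1 = 2 *: (2^-1 * t `^ (2^-1 - 1)).
      rewrite /GRing.scale/= mulrA mulfV ?mul1r// -powRN; congr (_ `^ _).
      by field.
    exact: (is_deriveZ _ (is_derive1_powR _ t0)).
  have cG (t : R) : 0 < t -> {for t, continuous G}.
    by move=> t0; have [d _] := dG t t0; exact/differentiable_continuous/derivable1_diffP.
  rewrite (@continuous_FTC2 _ _ G _ _ i1).
  - by rewrite -EFinB lee_fin /G powR1 mulr1 lerBlDr lerDl mulr_ge0// powR_ge0.
  - apply: derivable_within_continuous => x; rewrite in_itv/= => /andP[ax _].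
    have x0 : 0 < x := lt_le_trans a0 ax.
    apply: derivableV; first by rewrite gt_eqF// powR_gt0.
    by apply: derivable_powR; rewrite in_itv/= x0.
  - split.
    + by move=> x /[!in_itv]/= /andP[ax _]; have [] := dG x (lt_trans a0 ax).
    + by apply: cvg_at_right_filter; exact: cG.
    + by apply: cvg_at_left_filter; exact: cG.
  - move=> x /[!in_itv]/= /andP[ax _]; rewrite derive1E.
    by have [_ ->] := dG x (lt_trans a0 ax).
rewrite FE.
have mFi i : measurable (F i) by exact: measurable_itv.
have mfF i : measurable_fun (F i) (fun t : R => ((t `^ 2^-1)^-1)%:E).
  exact: measurable_funTS.
have f0 i (x : R) : F i x -> (0 <= ((x `^ 2^-1)^-1)%:E)%E.
  by move=> _; rewrite lee_fin invr_ge0 powR_ge0.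
have H : (\int[mu]_(t in F i) ((t `^ 2^-1)^-1)%:E)%E @[i --> \oo] -->
    (\int[mu]_(t in \bigcup_i F i) ((t `^ 2^-1)^-1)%:E)%E.
  exact: ge0_nondecreasing_set_cvg_integral.
by move: H; apply: cvge_le; exact: nearW.
Qed.

Lemma integral_expRN (r : R) : 0 < r ->
  (\int[mu]_(t in `]0%R, +oo[) (expR (- (r * t)))%:E = (r^-1)%:E)%E.
Proof.
move=> r0.
have me : measurable_fun setT (fun t : R => expR (- (r * t))).
  by apply: measurableT_comp => //; apply: measurableT_comp => //; exact: measurable_funM.
rewrite integral_itv_obnd_cbnd; last exact/measurable_EFinP/measurable_funTS.
have : (\int[mu]_(x in `[0%R, +oo[) (r * expR (- r * x))%:E = 1)%E.
  rewrite integral_mkcond -[RHS](integral_exponential_pdf r0).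
  apply: eq_integral => x _; rewrite /exponential_pdf !patchE /=.
  by case: ifP.
under eq_integral do rewrite EFinM mulNr.
rewrite ge0_integralZl_EFin ?ltW//; last exact/measurable_EFinP/measurable_funTS.
move=> H.
have := congr1 (fun x => (r^-1)%:E * x)%E H.
by rewrite muleA -EFinM mulVf ?gt_eqF// mul1e mule1.
Qed.

End power_integrals.

Section gamma_limit.
Context {R : realType}.
Local Notation mu := (@lebesgue_measure R).

Lemma powRN_expR (t s : R) : 0 < t -> t `^ (- s) = expR (- (s * ln t)).
Proof. by move=> t0; rewrite /powR gt_eqF// mulNr. Qed.

(* Chord of the convex function [s |-> t `^ (- s)] over [0, 1/2]. *)
Lemma powRN_le (t s : R) : 0 < t -> 0 <= s -> s <= 2^-1 ->
  t `^ (- s) <= 1 + 2 * s * (t `^ 2^-1)^-1.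
Proof.
move=> t0 s0 s1; rewrite -powRN powRN_expR// powRN_expR//.
set x := - (2^-1 * ln t); set q := 2 * s.
have q0 : 0 <= q by rewrite mulr_ge0.
have q1 : q <= 1 by rewrite /q; lra.
have -> : - (s * ln t) = q * x by rewrite /q /x; field.
have tangent y : expR (q * x) * (1 + (y - q * x)) <= expR y.
  rewrite -[in leRHS](subrK (q * x) y) expRD mulrC ler_wpM2r ?expR_ge0//.
  exact: expR_ge1Dx.
have := ler_wpM2l q0 (tangent x).
have := tangent 0; rewrite expR0 sub0r.
have q1' : 0 <= 1 - q by rewrite subr_ge0.
move=> /(ler_wpM2l q1'); set a := expR _; set b := expR _ => h1 h2.
have -> : a = (1 - q) * (a * (1 - q * x)) + q * (a * (1 + (x - q * x))) by ring.
by move: h1 h2; lra.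
Qed.

(** The inequality [1 + y <= exp y], used at [- s ln t] and again at [ln t] to get [ln t <= t]. *)
Lemma powRN_ge (t s : R) : 0 < t -> 0 <= s -> 1 - s * t <= t `^ (- s).
Proof.
move=> t0 s0; rewrite powRN_expR//; apply: le_trans (expR_ge1Dx _).
rewrite lerD2l lerN2 ler_wpM2l//.
have := expR_ge1Dx (ln t); rewrite lnK ?posrE//.
by apply: le_trans; rewrite lerDr.
Qed.

Let I : set R := `]0%R, +oo[%classic.
Let I0 t : I t -> 0 < t. Proof. by rewrite /I /= in_itv/= andbT. Qed.
Let mI : measurable I. Proof. exact: measurable_itv. Qed.

(** The integral for [Gamma (1 - s)], kept in the extended reals until the bounds show that it is
    finite. *)
Let gamma (s : R) := (\int[mu]_(t in I) (t `^ (- s) * expR (- t))%:E)%E.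

Let mexpN (r : R) : measurable_fun setT (fun t : R => expR (- (r * t))).
Proof.
by apply: measurableT_comp => //; apply: measurableT_comp => //; exact: measurable_funM.
Qed.

Let mgamma (s : R) : measurable_fun I (fun t : R => (t `^ (- s) * expR (- t))%:E).
Proof.
apply/measurable_EFinP/measurable_funTS; apply: measurable_funM.
  exact: measurable_powR.
by apply: measurableT_comp => //; exact: measurableT_comp.
Qed.

Let int_exp1 : (\int[mu]_(t in I) (expR (- t))%:E = 1)%E.
Proof.
have := integral_expRN (1 : R) ltr01; rewrite invr1 => <-.
by apply: eq_integral => t _; rewrite mul1r.
Qed.

Let mexp1 : measurable_fun I (fun t : R => (expR (- t))%:E).
Proof.
by apply/measurable_EFinP/measurable_funTS; apply: measurableT_comp.
Qed.

(** By [powRN_le] the excess over [exp (-t)] is at most [2 s t^{-1/2} exp (-t)]. Bounding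
    [t^{-1/2} exp (-t)] by [t^{-1/2}] on []0, 1]] and by [exp (-t)] beyond gives [6 = 2 (2 + 1)]. *)
Let gamma_le (s : R) : 0 < s -> s <= 2^-1 -> (gamma s <= (1 + 6 * s)%:E)%E.
Proof.
move=> s0 s1.
pose g (t : R) := ((2 * s)%:E *
  (((t `^ 2^-1)^-1 * \1_(`]0%R, 1%R]%classic) t)%R%:E + (expR (- t))%:E))%E.
have mr : measurable_fun I (fun t : R => ((t `^ 2^-1)^-1 * \1_(`]0%R, 1%R]%classic) t)%:E).
  apply/measurable_EFinP/measurable_funTS; apply: measurable_funM.
    have -> : (fun t : R => (t `^ 2^-1)^-1) = fun t => t `^ (- 2^-1).
      by apply/funext => t; rewrite powRN.
    exact: measurable_powR.
  exact: measurable_indic.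
have r0 t : (0 <= ((t `^ 2^-1)^-1 * \1_(`]0%R, 1%R]%classic) t)%:E)%E.
  by rewrite lee_fin mulr_ge0// invr_ge0 powR_ge0.
have g0 t : (0 <= g t)%E.
  apply: mule_ge0; first by rewrite lee_fin mulr_ge0 ?(ltW s0).
  by apply: adde_ge0; [exact: r0|rewrite lee_fin expR_ge0].
have mg : measurable_fun I g.
  by apply: measurable_funeM; exact: emeasurable_funD.
apply: (@le_trans _ _ (\int[mu]_(t in I) ((expR (- t))%:E + g t))%E).
  apply: ge0_le_integral => //.
  - by move=> t _; rewrite lee_fin mulr_ge0 ?powR_ge0 ?expR_ge0.
  - exact: mgamma.
  - exact: emeasurable_funD.
  - move=> t /I0 t0.
    have -> : ((expR (- t))%:E + g t = (expR (- t) + 2 * s *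
        ((t `^ 2^-1)^-1 * \1_(`]0%R, 1%R]%classic) t + expR (- t)))%R%:E)%E by [].
    rewrite lee_fin.
    have e1 : expR (- t) <= 1 by rewrite -expR0 ler_expR oppr_le0 ltW.
    have e0 := expR_gt0 (- t).
    have := powRN_le t s t0 (ltW s0) s1.
    have p0 : 0 <= (t `^ 2^-1)^-1 by rewrite invr_ge0 powR_ge0.
    have pw : (t `^ 2^-1)^-1 * expR (- t) <= (t `^ 2^-1)^-1 * \1_(`]0%R, 1%R]%classic) t + expR (- t).
      rewrite indicE mem_setE/= in_itv/= t0/=; have [t1|t1] := leP t 1.
        by rewrite mulr1 -[leLHS]addr0 lerD ?(ltW e0)// ler_piMr.
      rewrite mulr0 add0r ler_piMl ?(ltW e0)//.
      rewrite invf_le1 ?powR_gt0// -[leLHS](powRr0 t).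
      by apply: ler_powR; rewrite ?(ltW t1).
    move=> H; apply: (@le_trans _ _ ((1 + 2 * s * (t `^ 2^-1)^-1) * expR (- t))).
      by rewrite ler_wpM2r// ltW.
    rewrite mulrDl mul1r lerD2l -mulrA ler_wpM2l// mulr_ge0// ltW//.
rewrite ge0_integralD//=.
rewrite int_exp1 EFinD leeD2l// /g ge0_integralZl_EFin//=; last 3 first.
- by move=> t _; apply: adde_ge0; [exact: r0|rewrite lee_fin expR_ge0].
- exact: emeasurable_funD.
- by rewrite mulr_ge0// ltW.
rewrite ge0_integralD//=.
have -> : 6 * s = 2 * s * (2 + 1) by ring.
rewrite [leRHS]EFinM lee_wpmul2l ?lee_fin ?mulr_ge0 ?(ltW s0)// EFinD int_exp1 leeD2r//.
apply: le_trans integral_rsqrt_le2.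
rewrite le_eqVlt; apply/orP; left; apply/eqP.
rewrite [LHS]integral_mkcond [RHS]integral_mkcond; apply: eq_integral => t _.
rewrite !patchE indicE; case: ifPn => [/set_mem/I0 t0|tI].
  by case: ifPn => _; rewrite ?mulr1// mulr0.
case: ifPn => // /set_mem; rewrite /= in_itv/= => /andP[t0 _].
by move: tI; rewrite notin_setE /I /= in_itv/= t0.
Qed.

(** By [powRN_ge] the deficit is at most [s t exp (-t)], and [t exp (-t/2) <= 2] bounds this by
    [2 s exp (-t/2)], of integral [4 s]. The sum form avoids a subtraction in the extended reals. *)
Let gamma_ge (s : R) : 0 < s -> (1%E <= gamma s + (4 * s)%:E)%E.
Proof.
move=> s0.
have m2 : measurable_fun I (fun t : R => (expR (- (2^-1 * t)))%:E).
  exact/measurable_EFinP/measurable_funTS.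
have -> : ((4 * s)%:E = \int[mu]_(t in I) ((2 * s)%:E * (expR (- (2^-1 * t)))%:E))%E.
  rewrite ge0_integralZl_EFin//; last by rewrite mulr_ge0// ltW.
  by rewrite integral_expRN ?invr_gt0// invrK -EFinM; congr EFin; ring.
have mm : measurable_fun I (fun t : R => ((2 * s)%:E * (expR (- (2^-1 * t)))%:E)%E).
  exact: measurable_funeM.
rewrite -int_exp1 /gamma -ge0_integralD//=; last 3 first.
- by move=> t _; rewrite lee_fin mulr_ge0 ?powR_ge0 ?expR_ge0.
- exact: mgamma.
- by move=> t _; rewrite lee_fin !mulr_ge0 ?expR_ge0 ?(ltW s0).
apply: ge0_le_integral => //.
- exact: (emeasurable_funD (mgamma s) mm).
- move=> t /I0 t0; rewrite -EFinM -EFinD lee_fin.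
  have e0 := expR_gt0 (- (2^-1 * t)).
  have -> : expR (- t) = expR (- (2^-1 * t)) * expR (- (2^-1 * t)).
    by rewrite -expRD; congr expR; field.
  have := powRN_ge t s t0 (ltW s0).
  have := expR_ge1Dx (2^-1 * t).
  have := expRN (2^-1 * t).
  have := expR_gt0 (2^-1 * t).
  move: e0; set a := expR (- _); set b := expR (2^-1 * t); set p := t `^ _.
  move=> a0 b0 ab hb hp.
  have ab1 : a * b = 1 by rewrite ab mulVf// gt_eqF.
  have ta : t * a <= 2.
    rewrite (_ : 2 = 2 * b * a); last by rewrite -mulrA [b * a]mulrC ab1 mulr1.
    by rewrite ler_wpM2r ?(ltW a0)//; move: hb; lra.
  have : (1 - s * t) * (a * a) <= p * (a * a).
    by rewrite ler_wpM2r// mulr_ge0 ?ltW.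
  have : s * a * (t * a) <= s * a * 2.
    by rewrite ler_wpM2l// mulr_ge0 ?ltW.
  lra.
Qed.

Lemma cvg_Gamma_1B : Gamma (1 - s) @[s --> 0^'+] --> (1 : R).
Proof.
have GE (s : R) : Gamma (1 - s) = fine (gamma s).
  by rewrite /Gamma /Rintegral addrAC subrr add0r.
have bounds : \forall s \near 0^'+, 1 - 4 * s <= Gamma (1 - s) <= (1 + 6 * s : R).
  near=> s.
  have s0 : 0 < s by near: s; exact: nbhs_right_gt.
  have s1 : s <= 2^-1 by near: s; apply: nbhs_right_le; rewrite invr_gt0.
  have le6 := gamma_le s s0 s1; have ge4 := gamma_ge s s0.
  have g0 : (0 <= gamma s)%E.
    by apply: integral_ge0 => t _; rewrite lee_fin mulr_ge0 ?powR_ge0 ?expR_ge0.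
  have gfin : gamma s \is a fin_num by rewrite ge0_fin_numE// (le_lt_trans le6)// ltry.
  rewrite GE; move: le6 ge4; rewrite -(fineK gfin) lee_fin -EFinD lee_fin => -> /=.
  by rewrite lerBlDr => ->.
apply: (squeeze_cvgr bounds).
- rewrite -[X in _ --> X]subr0 -[X in _ - X](mulr0 4).
  apply: cvgB; first exact: cvg_cst.
  apply: cvgMl_tmp; apply: cvg_at_right_filter; exact: cvg_id.
- rewrite -[X in _ --> X]addr0 -[X in _ + X](mulr0 6).
  apply: cvgD; first exact: cvg_cst.
  apply: cvgMl_tmp; apply: cvg_at_right_filter; exact: cvg_id.
Unshelve. all: by end_near. Qed.

End gamma_limit.

(** * Averaging by a Markov kernel that spreads out *)

(** The kernel is known to be measurable for [t > 0] only, so the theorems on the full product are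
    applied to its extension by zero. *)
Lemma measurable_integral_restrict {d d'} {U : measurableType d} {T : measurableType d'}
    {R : realType} (mu : {sigma_finite_measure set T -> \bar R}) (E : set U)
    (phi : U -> T -> \bar R) :
  measurable E -> measurable_fun (E `*` setT) (fun z => phi z.1 z.2) ->
  (forall u x, E u -> (0 <= phi u x)%E) ->
  measurable_fun E (fun u => \int[mu]_x phi u x)%E.
Proof.
move=> mE mphi phi0; pose psi := (fun z => phi z.1 z.2) \_ (E `*` setT).
have mpsi : measurable_fun setT psi.
  by apply/(measurable_restrictT _ _).1 => //; exact: measurableX.
have psi0 z : (0 <= psi z)%E.
  by rewrite /psi patchE; case: ifPn => // /set_mem[/= Ez _]; exact: phi0.
apply: (eq_measurable_fun (fun u => \int[mu]_x psi (u, x))%E).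
  move=> u uE; apply: eq_integral => x _; rewrite /psi patchE ifT//.
  by apply/mem_set; split => //; exact: set_mem.
by apply: measurable_funTS; exact: (measurable_fun_fubini_tonelli_F _ mpsi psi0).
Qed.

Lemma tonelli_restrict {d d'} {U : measurableType d} {T : measurableType d'} {R : realType}
    (nu : {sigma_finite_measure set U -> \bar R})
    (mu : {sigma_finite_measure set T -> \bar R}) (E : set U) (phi : U -> T -> \bar R) :
  measurable E -> measurable_fun (E `*` setT) (fun z => phi z.1 z.2) ->
  (forall u x, E u -> (0 <= phi u x)%E) ->
  [/\ measurable_fun E (fun u => \int[mu]_x phi u x)%E,
      measurable_fun setT (fun x => \int[nu]_(u in E) phi u x)%E &
      (\int[nu]_(u in E) \int[mu]_x phi u x = \int[mu]_x \int[nu]_(u in E) phi u x)%E].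
Proof.
move=> mE mphi phi0; pose psi := (fun z => phi z.1 z.2) \_ (E `*` setT).
have mpsi : measurable_fun setT psi.
  by apply/(measurable_restrictT _ _).1 => //; exact: measurableX.
have psi0 z : (0 <= psi z)%E.
  by rewrite /psi patchE; case: ifPn => // /set_mem[/= Ez _]; exact: phi0.
have psiE u x : psi (u, x) = (phi^~ x \_ E) u.
  rewrite /psi !patchE; case: ifPn => [/set_mem[/= Eu _]|].
    by rewrite ifT//; exact/mem_set.
  by case: ifPn => // /set_mem Eu /negP; case; apply/mem_set.
have psiF u : (\int[mu]_x psi (u, x))%E = ((fun u => \int[mu]_x phi u x)%E \_ E) u.
  rewrite patchE; case: ifPn => uE.
    by apply: eq_integral => x _; rewrite psiE patchE uE.
  rewrite (eq_integral (cst 0%E)) ?integral0// => x _.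
  by rewrite psiE patchE (negbTE uE).
have psiG x : (\int[nu]_u psi (u, x))%E = (\int[nu]_(u in E) phi u x)%E.
  by rewrite [RHS]integral_mkcond; apply: eq_integral => u _; rewrite psiE.
split.
- exact: measurable_integral_restrict.
- by rewrite -(funext psiG); exact: (measurable_fun_fubini_tonelli_G _ mpsi psi0).
- rewrite integral_mkcond -(eq_integral _ _ (fun u _ => psiF u)).
  by rewrite (fubini_tonelli psi mpsi psi0); apply: eq_integral => x _; rewrite psiG.
Qed.

Lemma cvg_powRN {R : realType} (a : R) : 0 < a -> a `^ (- s) @[s --> 0^'+] --> (1 : R).
Proof.
move=> a0; apply: cvg_at_right_filter.
have -> : (fun s => a `^ (- s)) = expR \o (fun s => - s * ln a).
  by apply/funext => s /=; rewrite /powR gt_eqF.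
rewrite -[X in _ --> X](@expR0 R) -[X in expR X](mul0r (ln a)) -[X in X * _](@oppr0 R).
apply: continuous_comp; last exact: continuous_expR.
by apply: cvgMr_tmp; exact: continuousN.
Qed.

Section bounded_markov_kernel.
Context {d} {T : measurableType d} {R : realType}.
Context (mu : {sigma_finite_measure set T -> \bar R}).
Local Notation leb := (@lebesgue_measure R).
Context (p : T -> T -> R -> R) (c : R -> R) (f : T -> R).
Let I : set R := `]0%R, +oo[%classic.
Hypothesis mp : measurable_fun (I `*` setT) (fun z : R * (T * T) => p z.2.1 z.2.2 z.1).
Hypothesis p0 : forall X Y t, 0 < t -> 0 <= p X Y t.
Hypothesis pY : forall X t, 0 < t -> (\int[mu]_Y (p X Y t)%:E = 1)%E.
Hypothesis pX : forall Y t, 0 < t -> (\int[mu]_X (p X Y t)%:E = 1)%E.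
Hypothesis pc : forall X Y t, 0 < t -> p X Y t <= c t.
Hypothesis fL : f \in Lfun mu 1.
Hypothesis f0 : {ae mu, forall X, 0 <= f X}.

(** For [p := kernel_p Q B] this is convertible to [semigroup]. *)
Definition averaging (t : R) (X : T) : R := (\int[mu]_Y (p X Y t * f Y))%R.

Let n : R := fine (\int[mu]_X `|(f X)%:E|)%E.

Let mI : measurable I. Proof. exact: measurable_itv. Qed.

Let I0 t : I t -> 0 < t. Proof. by rewrite /I /= in_itv/= andbT. Qed.

Let It t : 0 < t -> I t. Proof. by rewrite /I /= in_itv/= andbT. Qed.

Let mf : measurable_fun setT f. Proof. exact: (Lfun1_measurable mu). Qed.

Let mabsf : measurable_fun setT (fun X => `|f X|).
Proof. exact: measurableT_comp. Qed.

Let nE : (\int[mu]_X (`|f X|)%:E)%E = n%:E.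
Proof. by rewrite /n fineK// ge0_fin_numE ?integral_ge0//; have /Lfun1_integrable/integrableP[] := fL. Qed.

Let n0 : 0 <= n.
Proof. by rewrite -lee_fin -nE integral_ge0. Qed.

Let mpt t : 0 < t -> measurable_fun setT (fun z : T * T => p z.1 z.2 t).
Proof.
move=> t0.
have mIT : measurable (I `*` [set: T * T]) by exact: measurableX.
have tIT : (fun z : T * T => (t, z)) @` setT `<=` I `*` setT.
  by move=> _ [z _ <-]; split => //; exact: It.
exact: (measurable_comp mIT tIT mp (measurable_pair1 t)).
Qed.

Let mpX X t : 0 < t -> measurable_fun setT (fun Y => p X Y t).
Proof. by move=> t0; exact: (measurableT_comp (mpt t t0) (measurable_pair1 X)). Qed.

Let c_ge0 (X : T) t : 0 < t -> 0 <= c t.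
Proof. by move=> t0; exact: le_trans (p0 X X t t0) (pc X X t t0). Qed.

Let averaging_lty X t : 0 < t -> (\int[mu]_Y (p X Y t * `|f Y|)%:E <= (c t * n)%:E)%E.
Proof.
move=> t0; rewrite EFinM -nE -ge0_integralZl_EFin//; first last.
- exact: (c_ge0 X).
- exact/measurable_EFinP.
apply: ge0_le_integral => //.
- by move=> Y _; rewrite lee_fin mulr_ge0// p0.
- by apply/measurable_EFinP; apply: measurable_funM => //; exact: mpX.
- by apply: measurable_funeM; exact/measurable_EFinP.
- by move=> Y _; rewrite -EFinM lee_fin ler_wpM2r// pc.
Qed.

Let integrable_pf X t : 0 < t -> mu.-integrable setT (fun Y => (p X Y t * f Y)%:E).
Proof.
move=> t0; apply/integrableP; split.
  by apply/measurable_EFinP; apply: measurable_funM => //; exact: mpX.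
apply: le_lt_trans (ltry (c t * n)); apply: le_trans (averaging_lty X t t0).
rewrite le_eqVlt; apply/orP; left; apply/eqP; apply: eq_integral => Y _.
by rewrite /= normrM (ger0_norm (p0 X Y t t0)).
Qed.

(** As [f] is nonnegative only almost everywhere, [|f|] replaces it to make the integrand
    nonnegative at every point, as Tonelli's theorem asks. *)
Lemma averagingE X t : 0 < t ->
  ((averaging t X)%:E = \int[mu]_Y (p X Y t * `|f Y|)%:E)%E.
Proof.
move=> t0; rewrite /averaging /Rintegral fineK; last first.
  exact: (integrable_fin_num measurableT (integrable_pf X t t0)).
apply: ae_eq_integral => //.
- by apply/measurable_EFinP; apply: measurable_funM => //; exact: mpX.
- by apply/measurable_EFinP; apply: measurable_funM => //; exact: mpX.
- by move: f0; apply: filterS => Y fY _; rewrite ger0_norm.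
Qed.

Lemma averaging_ge0 X t : 0 < t -> 0 <= averaging t X.
Proof.
move=> t0; rewrite -lee_fin averagingE// integral_ge0// => Y _.
by rewrite lee_fin mulr_ge0// p0.
Qed.

Lemma averaging_le X t : 0 < t -> averaging t X <= c t * n.
Proof. by move=> t0; rewrite -lee_fin averagingE// averaging_lty. Qed.

Lemma measurable_averaging :
  measurable_fun (I `*` setT) (fun z : R * T => averaging z.1 z.2).
Proof.
pose k (w : (R * T) * T) := (p w.1.2 w.2 w.1.1 * `|f w.2|)%:E.
have mIT : measurable (I `*` [set: T]) by exact: measurableX.
have mk : measurable_fun ((I `*` setT) `*` setT) (fun w => k (w.1, w.2)).
  apply/measurable_EFinP; apply: measurable_funM.
    have mITT : measurable (I `*` [set: T * T]) by exact: measurableX.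
    have sub : (fun w : (R * T) * T => (w.1.1, (w.1.2, w.2))) @` ((I `*` setT) `*` setT) `<=` I `*` setT.
      by move=> _ [w [[/= Iw _] _] <-].
    apply: (measurable_comp mITT sub mp); apply: measurable_funTS.
    apply: measurable_fun_pair; first exact: measurableT_comp.
    by apply: measurable_fun_pair => //; exact: measurableT_comp.
  apply: measurable_funTS; exact: (measurableT_comp mabsf measurable_snd).
have mF := measurable_integral_restrict mu (I `*` setT) (fun z Y => k (z, Y)) mIT mk.
apply: (eq_measurable_fun (fun z => fine (\int[mu]_Y k (z, Y))%E)).
  by move=> [t X] /set_mem[/= /I0 t0 _]; rewrite /k/= -averagingE.
by apply: measurableT_comp => //; apply: mF => u x [/= /I0 u0 _]; rewrite /k/= lee_fin mulr_ge0// p0.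
Qed.

Let mavg t : 0 < t -> measurable_fun setT (averaging t).
Proof.
move=> t0.
have mIT : measurable (I `*` [set: T]) by exact: measurableX.
have tIT : (fun z : T => (t, z)) @` setT `<=` I `*` setT.
  by move=> _ [z _ <-]; split => //; exact: It.
exact: (measurable_comp mIT tIT measurable_averaging (measurable_pair1 t)).
Qed.

Lemma integral_averaging t : 0 < t -> (\int[mu]_X (averaging t X)%:E = n%:E)%E.
Proof.
move=> t0; under eq_integral do rewrite averagingE//.
have mk : measurable_fun setT (fun z : T * T => (p z.1 z.2 t * `|f z.2|)%:E).
  apply/measurable_EFinP; apply: measurable_funM; first exact: mpt.
  exact: (measurableT_comp mabsf measurable_snd).
have k0 (z : T * T) : (0 <= (p z.1 z.2 t * `|f z.2|)%:E)%E by rewrite lee_fin mulr_ge0// p0.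
rewrite (fubini_tonelli _ mk k0)/= -nE; apply: eq_integral => Y _.
under eq_integral do rewrite mulrC EFinM.
rewrite ge0_integralZl_EFin//; first by rewrite pX// mule1.
- by move=> X _; rewrite lee_fin p0.
- by apply/measurable_EFinP; exact: (measurableT_comp (mpt t t0) (pair2_measurable Y)).
Qed.

Let D t : \bar R := (\int[mu]_X (`|averaging t X - f X|)%:E)%E.

Let D_ge0 t : (0 <= D t)%E. Proof. exact: integral_ge0. Qed.

(** Mass 1 in [Y] turns [f X] into an average of a constant, so the difference is an average of
    [f Y - f X]. This carries the Besov bound over to [D]. *)
Lemma averaging_dist_le t : 0 < t ->
  (D t <= \int[mu]_X \int[mu]_Y (p X Y t * `|f Y - f X|)%:E)%E.
Proof.
move=> t0; have mk : measurable_fun setT (fun z : T * T => (p z.1 z.2 t * `|f z.2 - f z.1|)%:E).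
  apply/measurable_EFinP; apply: measurable_funM; first exact: mpt.
  by apply: measurableT_comp => //; apply: measurable_funB; exact: measurableT_comp.
have k0 (z : T * T) : (0 <= (p z.1 z.2 t * `|f z.2 - f z.1|)%:E)%E.
  by rewrite lee_fin mulr_ge0// p0.
apply: ge0_le_integral => //.
- apply/measurable_EFinP; apply: measurableT_comp => //; apply: measurable_funB => //.
  exact: mavg.
- exact: (measurable_fun_fubini_tonelli_F _ mk k0).
move=> X _.
have ip : mu.-integrable setT (fun Y => (p X Y t)%:E).
  apply/integrableP; split; first by apply/measurable_EFinP; exact: mpX.
  under eq_integral do rewrite /= (ger0_norm (p0 X _ t t0)).
  by rewrite pY// ltry.
have ipf : mu.-integrable setT (fun Y => (p X Y t * f X)%:E).
  by have := integrableZl measurableT (f X) ip; apply: eq_integrable => // Y _; rewrite -EFinM mulrC.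
have fXE : f X = (\int[mu]_Y (p X Y t * f X))%R.
  by rewrite RintegralZr// /Rintegral pY// mul1r.
rewrite {1}fXE /averaging -RintegralB//; last exact: integrable_pf.
have ib : mu.-integrable setT (fun Y => (p X Y t * f Y - p X Y t * f X)%:E).
  exact: (integrableB measurableT (integrable_pf X t t0) ipf).
rewrite EFin_normr_Rintegral//.
apply: le_trans (le_abse_integral mu measurableT (measurable_int mu ib)) _.
rewrite le_eqVlt; apply/orP; left; apply/eqP; apply: eq_integral => Y _.
by rewrite -mulrBr /= normrM (ger0_norm (p0 X Y t t0)).
Qed.

Lemma averaging_dist_le2 t : 0 < t -> (D t <= (2 * n)%:E)%E.
Proof.
move=> t0; have -> : ((2 * n)%:E = \int[mu]_X (averaging t X)%:E + \int[mu]_X (`|f X|)%:E)%E.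
  by rewrite integral_averaging// nE -EFinD; congr EFin; ring.
have ma := mavg t t0.
rewrite -ge0_integralD//=; last 3 first.
- by move=> X _; rewrite lee_fin averaging_ge0.
- exact/measurable_EFinP.
- exact/measurable_EFinP.
apply: ge0_le_integral => //.
- apply/measurable_EFinP; apply: measurableT_comp => //; exact: measurable_funB.
- by apply: emeasurable_funD; exact/measurable_EFinP.
- move=> X _; rewrite -EFinD lee_fin; apply: le_trans (ler_normB _ _) _.
  by rewrite lerD2r ger0_norm// averaging_ge0.
Qed.

Hypothesis c_small : forall e, 0 < e -> exists2 t0, 0 < t0 & forall t, t0 <= t -> c t <= e.
Context (sigma : R).
Hypothesis sigma01 : 0 < sigma < 1.
Hypothesis besov_lty : (\int[leb]_(t in I) (((t `^ (sigma / 2 + 1))^-1)%:E *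
  \int[mu]_X \int[mu]_Y (p X Y t * `|f Y - f X|)%:E) < +oo)%E.

Let K (s t : R) : R := (t `^ (1 + s))^-1.

Let K_ge0 s t : 0 <= K s t. Proof. by rewrite invr_ge0 powR_ge0. Qed.

Let mK s : measurable_fun setT (K s).
Proof.
rewrite (_ : K s = fun t => t `^ (- (1 + s))); first exact: measurable_powR.
by apply/funext => t; rewrite powRN.
Qed.

Let mdist : measurable_fun (I `*` setT)
  (fun z : R * T => (`|averaging z.1 z.2 - f z.2|)%:E).
Proof.
apply/measurable_EFinP; apply: measurableT_comp => //; apply: measurable_funB.
  exact: measurable_averaging.
by apply: measurable_funTS; exact: (measurableT_comp mf measurable_snd).
Qed.

Let mD : measurable_fun I D.
Proof.
exact: (measurable_integral_restrict mu I (fun t X => (`|averaging t X - f X|)%:E)).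
Qed.

Let mKD s : measurable_fun I (fun t => (K s t)%:E * D t)%E.
Proof. by apply: emeasurable_funM => //; apply/measurable_EFinP/measurable_funTS. Qed.

Let KD_ge0 s t : (0 <= (K s t)%:E * D t)%E.
Proof. by rewrite mule_ge0// lee_fin. Qed.

(** The weight of the Besov seminorm of order [sigma] is exactly [K (sigma / 2)]. *)
Let b : \bar R := (\int[leb]_(t in I) ((K (sigma / 2) t)%:E * D t))%E.

Let b_lty : (b < +oo)%E.
Proof.
apply: le_lt_trans besov_lty.
have mIT : measurable (I `*` [set: T]) by exact: measurableX.
have mk : measurable_fun ((I `*` setT) `*` setT)
    (fun w : (R * T) * T => (p w.1.2 w.2 w.1.1 * `|f w.2 - f w.1.2|)%:E).
  apply/measurable_EFinP; apply: measurable_funM.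
    have mITT : measurable (I `*` [set: T * T]) by exact: measurableX.
    have sub : (fun w : (R * T) * T => (w.1.1, (w.1.2, w.2))) @` ((I `*` setT) `*` setT) `<=` I `*` setT.
      by move=> _ [w [[/= Iw _] _] <-].
    apply: (measurable_comp mITT sub mp); apply: measurable_funTS.
    apply: measurable_fun_pair; first exact: measurableT_comp.
    by apply: measurable_fun_pair => //; exact: measurableT_comp.
  apply: measurable_funTS; apply: measurableT_comp => //; apply: measurable_funB.
    exact: (measurableT_comp mf measurable_snd).
  exact: (measurableT_comp mf (measurableT_comp measurable_snd measurable_fst)).
have mk1 : measurable_fun (I `*` setT)
    (fun z : R * T => \int[mu]_Y (p z.2 Y z.1 * `|f Y - f z.2|)%:E)%E.
  apply: (measurable_integral_restrict mu (I `*` setT)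
    (fun z Y => (p z.2 Y z.1 * `|f Y - f z.2|)%:E) mIT mk).
  by move=> z Y [/= /I0 z0 _]; rewrite lee_fin mulr_ge0// p0.
have mk2 : measurable_fun I (fun t => \int[mu]_X \int[mu]_Y (p X Y t * `|f Y - f X|)%:E)%E.
  apply: (measurable_integral_restrict mu I
    (fun t X => \int[mu]_Y (p X Y t * `|f Y - f X|)%:E)%E mI mk1).
  by move=> t X /I0 t0; apply: integral_ge0 => Y _; rewrite lee_fin mulr_ge0// p0.
apply: ge0_le_integral => //.
- exact: mKD.
- apply: emeasurable_funM => //; apply/measurable_EFinP/measurable_funTS.
  by move: (mK (sigma / 2)); rewrite /K addrC.
- by move=> t /I0 t0; rewrite /K addrC lee_wpmul2l ?lee_fin ?invr_ge0 ?powR_ge0// averaging_dist_le.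
Qed.

Let B : R := fine b.

Let bE : b = B%:E.
Proof. by rewrite /B fineK// ge0_fin_numE// integral_ge0. Qed.

Let B_ge0 : 0 <= B. Proof. by rewrite -lee_fin -bE integral_ge0. Qed.

Let near_sub (t1 : R) : `]0%R, t1[%classic `<=` I.
Proof. by move=> t; rewrite /I /= !in_itv/= andbT => /andP[]. Qed.

Let far_sub (t1 : R) : 0 < t1 -> `[t1, +oo[%classic `<=` I.
Proof. by move=> t10 t; rewrite /I /= !in_itv/= !andbT; exact: lt_le_trans. Qed.

Let near_far (t1 : R) : 0 < t1 -> I = `]0%R, t1[%classic `|` `[t1, +oo[%classic.
Proof.
move=> t10; apply/seteqP; split => [t /I0 t0|t [/near_sub//|/(far_sub t1 t10)//]].
by have [tt|tt] := ltP t t1; [left|right]; rewrite /= in_itv/= ?t0 ?tt.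
Qed.

Let near_far_disj (t1 : R) : [disjoint `]0%R, t1[%classic & `[t1, +oo[%classic].
Proof.
apply/disj_setPS => t [/=]; rewrite !in_itv/= andbT => /andP[_ tt1] t1t.
by move: (lt_le_trans tt1 t1t); rewrite ltxx.
Qed.

(** The bound is uniform in [s]: for [t < t1] the weight is [K (sigma / 2) t] times
    [t^{sigma/2 - s}], whose exponent lies in [[0, 1]], and [t1 >= 1] makes that factor at most
    [t1]. *)
Let near_le s t1 : 0 < s -> s <= sigma / 2 -> 1 <= t1 ->
  (\int[leb]_(t in `]0%R, t1[) ((K s t)%:E * D t) <= (t1 * B)%:E)%E.
Proof.
move=> s0 ss t11.
have t10 : 0 < t1 := lt_le_trans ltr01 t11.
apply: (@le_trans _ _ (\int[leb]_(t in `]0%R, t1[) (t1%:E * ((K (sigma / 2) t)%:E * D t)))%E).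
  apply: ge0_le_integral => //.
  - exact: measurable_funS (mKD s).
  - by apply: measurable_funeM; exact: measurable_funS (mKD _).
  - move=> t /= ; rewrite in_itv/= => /andP[t0 tt1].
    rewrite muleA -EFinM lee_wpmul2r// lee_fin /K.
    have -> : (t `^ (1 + s))^-1 = t `^ (sigma / 2 - s) * (t `^ (1 + sigma / 2))^-1.
      rewrite -!powRN -powRD; last by apply/implyP => _; rewrite gt_eqF.
      by congr (_ `^ _); ring.
    rewrite ler_wpM2r ?invr_ge0 ?powR_ge0//.
    apply: (@le_trans _ _ (t1 `^ (sigma / 2 - s))).
      by apply: ge0_ler_powR; rewrite ?nnegrE ?subr_ge0 ?(ltW t0) ?(ltW t10) ?(ltW tt1).
    by apply: ler1_powR => //; case/andP: sigma01 => ? ?; lra.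
rewrite ge0_integralZl_EFin//; last 2 first.
- exact: measurable_funS (mKD _).
- exact: ltW.
rewrite EFinM lee_wpmul2l ?lee_fin ?(ltW t10)// -bE.
apply: ge0_subset_integral; [exact: measurable_itv|exact: mI|exact: mKD|
  by move=> t _; exact: KD_ge0|exact: near_sub].
Qed.

Let far_le s t1 : 0 < s -> 0 < t1 ->
  (\int[leb]_(t in `[t1, +oo[) ((K s t)%:E * D t) <= (s^-1 * t1 `^ (- s) * (2 * n))%:E)%E.
Proof.
move=> s0 t10; rewrite EFinM -integral_powR_tail// muleC.
have mKf : measurable_fun `[t1, +oo[ (fun t : R => (K s t)%:E).
  exact/measurable_EFinP/measurable_funTS.
rewrite -ge0_integralZl_EFin//; last 2 first.
- by move=> t _; rewrite lee_fin K_ge0.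
- by rewrite mulr_ge0.
apply: ge0_le_integral => //.
- exact: measurable_funS (far_sub t1 t10) (mKD s).
- exact: measurable_funeM.
- move=> t /(far_sub t1 t10)/I0 t0; rewrite muleC lee_wpmul2r ?lee_fin ?K_ge0//.
  exact: averaging_dist_le2.
Qed.

Let F (s t : R) (X : T) : R := K s t * (averaging t X - f X).

Let mF s : measurable_fun (I `*` setT) (fun z => F s z.1 z.2).
Proof.
apply: measurable_funM.
  by apply: measurable_funTS; exact: (measurableT_comp (mK s) measurable_fst).
apply: measurable_funB; first exact: measurable_averaging.
by apply: measurable_funTS; exact: (measurableT_comp mf measurable_snd).
Qed.

Let normF s t : I t -> (\int[mu]_X `|(F s t X)%:E| = (K s t)%:E * D t)%E.
Proof.
move=> /I0 t0; rewrite -ge0_integralZl_EFin//.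
- by apply: eq_integral => X _; rewrite /F /= normrM ger0_norm.
- apply/measurable_EFinP; apply: measurableT_comp => //; apply: measurable_funB => //.
  exact: mavg.
Qed.

(** Splitting at time 1 gives integrability and, after multiplication by [s], the upper half of the
    limit. *)
Let KD_le s : 0 < s -> s <= sigma / 2 ->
  (\int[leb]_(t in I) ((K s t)%:E * D t) <= (B + s^-1 * (2 * n))%:E)%E.
Proof.
move=> s0 ss; rewrite (near_far 1 ltr01) ge0_integral_setU//=; last first.
  by rewrite -near_far//; exact: mKD.
rewrite EFinD leeD//.
  by apply: le_trans (near_le s 1 s0 ss (lexx _)) _; rewrite mul1r.
by apply: le_trans (far_le s 1 s0 ltr01) _; rewrite powR1 mulr1.
Qed.

Let FL s t : I t -> F s t \in Lfun mu 1.
Proof.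
move=> It'; have t0 := I0 t It'; apply/Lfun1_integrable/integrableP; split.
  apply/measurable_EFinP; apply: measurable_funM => //; apply: measurable_funB => //.
  exact: mavg.
rewrite normF//; apply: (@le_lt_trans _ _ ((K s t)%:E * (2 * n)%:E)%E).
  by rewrite lee_wpmul2l ?lee_fin// averaging_dist_le2.
by rewrite -EFinM ltry.
Qed.

Let iF s : 0 < s -> s <= sigma / 2 ->
  (\int[leb]_(t in I) \int[mu]_X `|(F s t X)%:E| < +oo)%E.
Proof.
move=> s0 ss; apply: le_lt_trans (ltry (B + s^-1 * (2 * n))).
apply: le_trans (KD_le s s0 ss); rewrite le_eqVlt; apply/orP; left; apply/eqP.
by apply: eq_integral => t /set_mem It'; rewrite normF.
Qed.

Let G s := pointwise_integral leb I (F s).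

Let mG s : 0 < s -> s <= sigma / 2 -> measurable_fun setT (G s).
Proof.
move=> s0 ss.
have [_ + _] := is_L1_integral_pointwise leb mu I (F s) mI (mF s) (FL s) (iF s s0 ss).
exact: Lfun1_measurable.
Qed.

Let mabsF s (E : set R) : measurable E -> E `<=` I ->
  measurable_fun (E `*` setT) (fun z : R * T => `|(F s z.1 z.2)%:E|%E).
Proof.
move=> mE EI; apply: (measurable_funS (E := I `*` setT)).
- exact: measurableX.
- by move=> z [/= /EI].
- by apply: measurableT_comp => //; apply/measurable_EFinP; exact: mF.
Qed.

Let normG_le s : 0 < s -> s <= sigma / 2 ->
  (\int[mu]_X `|(G s X)%:E| <= (B + s^-1 * (2 * n))%:E)%E.
Proof.
move=> s0 ss; apply: le_trans (KD_le s s0 ss).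
have [_ mi eqi] := tonelli_restrict leb mu I (fun t X => `|(F s t X)%:E|%E) mI
  (mabsF s I mI (@subset_refl _ I)) (fun t X _ => abse_ge0 _).
have -> : (\int[leb]_(t in I) ((K s t)%:E * D t) =
    \int[leb]_(t in I) \int[mu]_X `|(F s t X)%:E|)%E.
  by apply: eq_integral => t /set_mem It'; rewrite normF.
rewrite eqi; apply: ge0_le_integral => //.
  by apply: measurableT_comp => //; apply/measurable_EFinP; exact: mG.
move=> X _; rewrite /G /pointwise_integral /Rintegral.
apply: (@le_trans _ _ `|\int[leb]_(t in I) (F s t X)%:E|%E).
  by case: (\int[_]_(_ in _) _)%E => [r| |] //=; rewrite ?normr0 ?leey.
apply: le_abse_integral => //.
have tIT : (fun t : R => (t, X)) @` I `<=` I `*` setT by move=> _ [t It' <-].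
have mIT : measurable (I `*` [set: T]) by exact: measurableX.
apply/measurable_EFinP; apply: (measurable_comp mIT tIT (mF s)).
exact/measurable_funTS/pair2_measurable.
Qed.

Let truncated (e : R) : \bar R := (\int[mu]_X (Num.min e `|f X|)%:E)%E.

Let mmin (e : R) : measurable_fun setT (fun X => (Num.min e `|f X|)%:E).
Proof.
under eq_fun do rewrite EFin_min.
by apply: measurable_mine => //; exact/measurable_EFinP.
Qed.

(** Dominated convergence along the heights [1/(k+1)], with [|f|] as the dominating function. *)
Let truncated_small (e : R) : 0 < e -> exists2 h, 0 < h & (truncated h <= e%:E)%E.
Proof.
move=> e0.
have inv0 k : 0 < k.+1%:R^-1 :> R by rewrite invr_gt0.
have min0 k X : 0 <= Num.min k.+1%:R^-1 `|f X| :> R by rewrite le_min (ltW (inv0 k))/=.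
have ifa : mu.-integrable setT (fun X => (`|f X|)%:E).
  by have /Lfun1_integrable/integrable_norm := fL.
have cvgf : {ae mu, forall X, setT X -> (Num.min k.+1%:R^-1 `|f X|)%:E @[k --> \oo] --> 0%E}.
  apply: aeW => X _; apply: cvg_EFin; first exact: nearW.
  apply: (@squeeze_cvgr _ _ _ _ (cst 0) (fun k => k.+1%:R^-1)); last 2 first.
  - exact: cvg_cst.
  - exact: cvg_harmonic.
  by apply: nearW => k; rewrite min0 ge_min lexx.
have dom : {ae mu, forall X k, setT X -> (`|(Num.min k.+1%:R^-1 `|f X|)%:E| <= (`|f X|)%:E)%E}.
  by apply: aeW => X k _; rewrite /= lee_fin ger0_norm// ge_min lexx orbT.
have [_ _] := @dominated_convergence _ T R mu setT measurableT
  (fun k X => (Num.min k.+1%:R^-1 `|f X|)%:E) (cst 0%E) (fun X => (`|f X|)%:E)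
  (fun k => mmin _) (measurable_cst _) cvgf ifa dom.
rewrite integral0 => cv.
have [k _ /(_ k (leqnn k)) /= kn] : \forall k \near \oo, (truncated k.+1%:R^-1 < e%:E)%E.
  by apply: (cv [set y | (y < e%:E)%E]); apply: open_ereal_lt'; rewrite lte_fin.
by exists k.+1%:R^-1 => //; exact: ltW.
Qed.

(* With [U] the far part of the integral of [K s t * averaging t], the far part
   of [G s] is [U - w * f], and [|U - w * f| = U + w * f - 2 * min U (w * f)],
   where [min U (w * f) <= w * min e f]. *)
Let normG_ge s t1 e : 0 < s -> s <= sigma / 2 -> 1 <= t1 -> 0 < e ->
  (forall t, t1 <= t -> c t * n <= e) ->
  ((s^-1 * t1 `^ (- s) * (2 * n))%:E <= \int[mu]_X `|(G s X)%:E| + (t1 * B)%:E +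
     (2 * (s^-1 * t1 `^ (- s)))%:E * truncated e)%E.
Proof.
move=> s0 ss t11 e0 ce; have t10 : 0 < t1 := lt_le_trans ltr01 t11.
set w := s^-1 * t1 `^ (- s).
have w0 : 0 <= w by rewrite mulr_ge0 ?powR_ge0// invr_ge0 ltW.
set Fa : set R := `[t1, +oo[%classic; set Ne : set R := `]0%R, t1[%classic.
have FaI : Fa `<=` I by exact: far_sub.
have NeI : Ne `<=` I by exact: near_sub.
have mFa : measurable Fa by exact: measurable_itv.
have mNe : measurable Ne by exact: measurable_itv.
have wE : (\int[leb]_(t in Fa) (K s t)%:E = w%:E)%E by exact: integral_powR_tail.
have mKs : measurable_fun Fa (fun t : R => (K s t)%:E).
  exact/measurable_EFinP/measurable_funTS.
pose U X := (\int[leb]_(t in Fa) (K s t * averaging t X)%:E)%E.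
(* Bounds the near part of [G s] at [X], which is treated as an error term. *)
pose V X := (\int[leb]_(t in Ne) `|(F s t X)%:E|)%E.
have mKa : measurable_fun (Fa `*` setT) (fun z : R * T => (K s z.1 * averaging z.1 z.2)%:E).
  apply/measurable_EFinP; apply: measurable_funM.
    by apply: measurable_funTS; exact: (measurableT_comp (mK s) measurable_fst).
  apply: (measurable_funS (E := I `*` setT)); last exact: measurable_averaging.
  - exact: measurableX.
  - by move=> z [/= /FaI].
have Ka0 t X : Fa t -> (0 <= (K s t * averaging t X)%:E)%E.
  by move=> /FaI/I0 t0; rewrite lee_fin mulr_ge0// averaging_ge0.
have [_ mU intU] := tonelli_restrict leb mu Fa (fun t X => (K s t * averaging t X)%:E) mFa mKa Ka0.
have [_ mV intV] := tonelli_restrict leb mu Ne (fun t X => `|(F s t X)%:E|%E) mNe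
  (mabsF s Ne mNe NeI) (fun t X _ => abse_ge0 _).
have [_ mW intW] := tonelli_restrict leb mu I (fun t X => `|(F s t X)%:E|%E) mI
  (mabsF s I mI (@subset_refl _ I)) (fun t X _ => abse_ge0 _).
have UE : (\int[mu]_X U X = (w * n)%:E)%E.
  rewrite -intU EFinM -wE muleC -ge0_integralZl_EFin//.
  - apply: eq_integral => t /set_mem/FaI/I0 t0.
    under eq_integral do rewrite EFinM.
    rewrite ge0_integralZl_EFin//.
    + by rewrite integral_averaging// muleC.
    + by move=> X _; rewrite lee_fin averaging_ge0.
    + by apply/measurable_EFinP; exact: mavg.
  - by move=> t _; rewrite lee_fin K_ge0.
have VE : (\int[mu]_X V X <= (t1 * B)%:E)%E.
  rewrite -intV; apply: le_trans (near_le s t1 s0 ss t11).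
  rewrite le_eqVlt; apply/orP; left; apply/eqP.
  by apply: eq_integral => t /set_mem/NeI It'; rewrite normF.
have Ule X : (U X <= (w * e)%:E)%E.
  rewrite EFinM -wE muleC -ge0_integralZl_EFin//; first last.
  - exact: ltW.
  - by move=> t _; rewrite lee_fin K_ge0.
  apply: ge0_le_integral => //.
  - by move=> t Ft; exact: Ka0.
  - have tIT : (fun t : R => (t, X)) @` Fa `<=` Fa `*` setT by move=> _ [t ? <-].
    apply: (measurable_comp (measurableX mFa measurableT) tIT mKa).
    exact/measurable_funTS/pair2_measurable.
  - exact: measurable_funeM.
  - move=> t Ft; have t0 := I0 t (FaI t Ft).
    rewrite -EFinM lee_fin mulrC ler_wpM2r//; apply: le_trans (averaging_le X t t0) _.
    by apply: ce; move: Ft; rewrite /Fa /= in_itv/= andbT.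
have U0 X : (0 <= U X)%E by apply: integral_ge0 => t; exact: Ka0.
have V0 X : (0 <= V X)%E by apply: integral_ge0.
have mF' X (E : set R) : measurable E -> E `<=` I -> measurable_fun E (fun t => (F s t X)%:E).
  move=> mE EI; apply/measurable_EFinP; apply: (measurable_funS mI EI).
  have tIT : (fun t : R => (t, X)) @` I `<=` I `*` setT by move=> _ [t ? <-].
  apply: (measurable_comp (measurableX mI measurableT) tIT (mF s)).
  exact/measurable_funTS/pair2_measurable.
(* Only almost everywhere: the integral over all times must be finite at [X] before [G s X] can be
   split, and [f X] must be nonnegative. *)
have key : {ae mu, forall X, setT X -> (U X + w%:E * (`|f X|)%:E <=
    `|(G s X)%:E| + V X + (2 * w)%:E * (Num.min e `|f X|)%:E)%E}.
  have iW : mu.-integrable setT (fun X => \int[leb]_(t in I) `|(F s t X)%:E|)%E.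
    apply/integrableP; split => //.
    under eq_integral do rewrite gee0_abs ?integral_ge0//.
    by rewrite -intW; exact: iF.
  have := integrable_ae measurableT iW; apply: filterS2 f0 => X fX /(_ Logic.I) Wfin _.
  have iFX : leb.-integrable I (fun t => (F s t X)%:E).
    apply/integrableP; split; first exact: mF'.
    by rewrite ltey_eq Wfin.
  have iNe : leb.-integrable Ne (fun t => (F s t X)%:E) by exact: integrableS iFX.
  pose gn := (\int[leb]_(t in Ne) F s t X)%R.
  have gnV : (`|gn|%:E <= V X)%E.
    by rewrite EFin_normr_Rintegral//; apply: le_abse_integral => //; exact: mF'.
  have Ufin : U X \is a fin_num by rewrite ge0_fin_numE// (le_lt_trans (Ule X))// ltry.
  have Vfin : V X \is a fin_num.
    rewrite ge0_fin_numE//; apply: le_lt_trans (_ : (\int[leb]_(t in I) `|(F s t X)%:E| < +oo)%E).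
      apply: ge0_subset_integral => //.
      by apply: measurableT_comp => //; exact: mF'.
    by rewrite ltey_eq Wfin.
  have iKa : leb.-integrable Fa (fun t => (K s t * averaging t X)%:E).
    apply/integrableP; split.
      have tIT : (fun t : R => (t, X)) @` Fa `<=` Fa `*` setT by move=> _ [t ? <-].
      apply: (measurable_comp (measurableX mFa measurableT) tIT mKa).
      exact/measurable_funTS/pair2_measurable.
    apply: le_lt_trans (_ : (U X < +oo)%E); last by rewrite -ge0_fin_numE.
    rewrite le_eqVlt; apply/orP; left; apply/eqP; apply: eq_integral => t /set_mem Ft.
    by rewrite gee0_abs// Ka0.
  have iKs : leb.-integrable Fa (fun t => (K s t)%:E).
    apply/integrableP; split => //.
    under eq_integral do rewrite gee0_abs ?lee_fin ?K_ge0//.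
    by rewrite wE ltry.
  have iKf : leb.-integrable Fa (fun t => (K s t * f X)%:E).
    have : leb.-integrable Fa (fun t => (f X)%:E * (K s t)%:E)%E by exact: integrableZl.
    by apply: eq_integrable => // t _; rewrite -EFinM mulrC.
  have GE : G s X = gn + (fine (U X) - w * f X).
    rewrite /G /pointwise_integral (near_far t1 t10) Rintegral_setU//; last first.
      by rewrite -near_far.
    congr (_ + _); rewrite /F; under eq_Rintegral do rewrite mulrBr.
    rewrite RintegralB// RintegralZr//; congr (_ - _ * _).
    by rewrite /Rintegral wE.
  pose u := fine (U X); pose v := fine (V X).
  have gnv : `|gn| <= v by rewrite -lee_fin /v fineK.
  have ule : u <= w * e by rewrite -lee_fin /u fineK.
  have u0 : 0 <= u by rewrite -lee_fin /u fineK.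
  have zn : `|u - w * f X| - `|gn| <= `|gn + (u - w * f X)|.
    by have := ler_normB (u - w * f X + gn) gn; rewrite addrK lerBlDr [gn + _]addrC.
  have z1 := ler_norm (u - w * f X).
  have z2 : w * f X - u <= `|u - w * f X| by rewrite distrC ler_norm.
  have wf0 : 0 <= w * f X by rewrite mulr_ge0.
  (* If [e <= f X], the sum is [(w f - u) + 2 u] with [u <= w e]; otherwise it is
     [(u - w f) + 2 w f] and the minimum is [f X]. *)
  have real : u + w * f X <= `|gn + (u - w * f X)| + v + 2 * w * Num.min e (f X).
    by case: (leP e (f X)) => _; lra.
  rewrite -(fineK Ufin) -(fineK Vfin) GE ger0_norm//.

have intL : (\int[mu]_X (U X + w%:E * (`|f X|)%:E) = (w * (2 * n))%:E)%E.
  rewrite ge0_integralD//; last 2 first.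
  - by move=> X _; rewrite mule_ge0// lee_fin.
  - by apply: measurable_funeM; exact/measurable_EFinP.
  rewrite UE ge0_integralZl_EFin//; last exact/measurable_EFinP.
  by rewrite nE -EFinM -EFinD; congr EFin; ring.
have mGs : measurable_fun setT (fun X => `|(G s X)%:E|%E).
  by apply: measurableT_comp => //; apply/measurable_EFinP; exact: mG.
have min0 X : (0 <= (2 * w)%:E * (Num.min e `|f X|)%:E)%E.
  apply: mule_ge0; first by rewrite lee_fin mulr_ge0.
  by rewrite lee_fin le_min (ltW e0)/=.
have mmin2 : measurable_fun setT (fun X => (2 * w)%:E * (Num.min e `|f X|)%:E)%E.
  exact: measurable_funeM.
rewrite -intL; apply: (@le_trans _ _
  (\int[mu]_X (`|(G s X)%:E| + V X + (2 * w)%:E * (Num.min e `|f X|)%:E))%E).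
  apply: ae_ge0_le_integral => //.
  - by move=> X _; apply: adde_ge0 => //; apply: mule_ge0.
  - by apply: emeasurable_funD => //; apply: measurable_funeM; exact/measurable_EFinP.
  - by move=> X _; apply: adde_ge0 => //; apply: adde_ge0.
  - by apply: emeasurable_funD => //; exact: emeasurable_funD.
rewrite ge0_integralD//; last 2 first.
- by move=> X _; rewrite adde_ge0.
- exact: emeasurable_funD.
rewrite ge0_integralD// ge0_integralZl_EFin//; last 2 first.
- by move=> X _; rewrite lee_fin le_min (ltW e0)/=.
- by rewrite mulr_ge0.
by rewrite leeD2r// leeD2l.
Qed.

Let Nn s : R := fine (\int[mu]_X `|(G s X)%:E|)%E.

Let NnE s : 0 < s -> s <= sigma / 2 -> (\int[mu]_X `|(G s X)%:E| = (Nn s)%:E)%E.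
Proof.
move=> s0 ss; rewrite /Nn fineK// ge0_fin_numE ?integral_ge0//.
exact: le_lt_trans (normG_le s s0 ss) (ltry _).
Qed.

(** The constants are chosen in order: a height [h] with small truncated mass, a time [t1] after
    which the averages stay below [h], and only then [s]. On the lower side the errors amount to
    [e/8] for the near part, [e/8] for [t1^{-s}] against 1 and [2 e/8] for the overlap. *)
Let cvg_sNn : s * Nn s @[s --> 0^'+] --> 2 * n.
Proof.
apply/cvgrPdist_le => e e0.
have [h h0 hle] := truncated_small (e / 8) (divr_gt0 e0 (ltr0Sn _ _)).
(* Dividing by [n + 1] allows [n = 0]. *)
have [t0 t00 ct] := c_small (h / (n + 1)) (divr_gt0 h0 (ltr_wpDl n0 ltr01)).
pose t1 := Num.max t0 1.
have t11 : 1 <= t1 by rewrite le_max lexx orbT.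
have t10 : 0 < t1 := lt_le_trans ltr01 t11.
have ct1 t : t1 <= t -> c t * n <= h.
  move=> tt; have tt0 : t0 <= t by rewrite (le_trans _ tt)// le_max lexx.
  apply: (@le_trans _ _ (h / (n + 1) * n)); first by rewrite ler_wpM2r// ct.
  by rewrite mulrAC ler_pdivrMr ?ltr_wpDl// ler_wpM2l ?(ltW h0)// lerDl.
have tm : fine (truncated h) <= e / 8.
  rewrite -lee_fin fineK// ge0_fin_numE ?(le_lt_trans hle) ?ltry//.
  by apply: integral_ge0 => X _; rewrite lee_fin le_min (ltW h0)/=.
have small a x : 0 <= a -> x <= e / 8 / (a + 1) -> x * a <= e / 8.
  move=> a0; rewrite ler_pdivlMr ?ltr_wpDl// mulrDr mulr1 => xa.
  have [x0|x0] := leP 0 x; first by lra.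
  by rewrite (le_trans (mulr_le0_ge0 (ltW x0) a0))// divr_ge0 ?(ltW e0).
have pos a : 0 <= a -> 0 < e / 8 / (a + 1) by move=> a0; rewrite !divr_gt0 ?ltr_wpDl.
near=> s.
have s0 : 0 < s by near: s; exact: nbhs_right_gt.
have ss : s <= sigma / 2.
  by near: s; apply: nbhs_right_le; rewrite divr_gt0//; case/andP: sigma01.
have up : s * Nn s <= s * B + 2 * n.
  have := normG_le s s0 ss; rewrite NnE// lee_fin => /(ler_wpM2l (ltW s0)).
  by rewrite mulrDr mulrA mulfV ?gt_eqF// mul1r.
have lo : t1 `^ (- s) * (2 * n) <= s * Nn s + s * (t1 * B) + 2 * t1 `^ (- s) * (e / 8).
  have tf : truncated h = (fine (truncated h))%:E.
    rewrite fineK// ge0_fin_numE ?(le_lt_trans hle) ?ltry//.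
    by apply: integral_ge0 => X _; rewrite lee_fin le_min (ltW h0)/=.
  have := normG_ge s t1 h s0 ss t11 h0 ct1.
  rewrite NnE// tf -EFinM -!EFinD lee_fin => /(ler_wpM2l (ltW s0)).
  rewrite !mulrDr !mulrA mulfV ?gt_eqF// mul1r => H.
  apply: le_trans H _; rewrite lerD2l.
  rewrite [s * 2 / s]mulrAC mulfV ?gt_eqF// mul1r.
  by rewrite -!mulrA ler_wpM2l// ler_wpM2l ?powR_ge0// mulrA.
have b1 : s * B <= e / 8.
  have /(small B) : s <= e / 8 / (B + 1).
    by near: s; apply: nbhs_right_le; apply: pos; rewrite ?mulr_ge0 ?(ltW t10).
  exact.
have b2 : s * (t1 * B) <= e / 8.
  have /(small (t1 * B)) : s <= e / 8 / (t1 * B + 1).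
    by near: s; apply: nbhs_right_le; apply: pos; rewrite ?mulr_ge0 ?(ltW t10).
  by apply; rewrite mulr_ge0 ?(ltW t10).
have b3 : `|1 - t1 `^ (- s)| * (2 * n) <= e / 8.
  apply: small; first by rewrite mulr_ge0.
  by near: s; move/cvgrPdist_le : (cvg_powRN t1 t10); apply; apply: pos; rewrite mulr_ge0.
have b4 : t1 `^ (- s) <= 1 by rewrite -(powRr0 t1) ler_powR// oppr_le0 ltW.
rewrite ler_norml; apply/andP; split.
  by lra.
have tp0 : 0 <= t1 `^ (- s) by exact: powR_ge0.
move: b3; rewrite ger0_norm ?subr_ge0// mulrBl mul1r => b3.
have : 2 * t1 `^ (- s) * (e / 8) <= 2 * (e / 8).
  by rewrite ler_wpM2r ?divr_ge0 ?(ltW e0)// -[leRHS]mulr1 ler_wpM2l.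
by lra.
Unshelve. all: by end_near.
Qed.

Lemma cvg_Lnorm1_L1_integral :
  ('N[mu]_1[EFin \o (fun X => - (s / Gamma (1 - s)) *
      L1_integral leb mu I (fun t Y => (t `^ (1 + s))^-1 * (averaging t Y - f Y)) X)%R])%E
    @[s --> 0^'+] --> (2 * 'N[mu]_1[EFin \o f])%E.
Proof.
have -> : (2 * 'N[mu]_1[EFin \o f] = (2 * n)%:E)%E by rewrite Lnorm1 nE.
have cv : `|(Gamma (1 - s))^-1| * (s * Nn s) @[s --> 0^'+] --> 2 * n.
  rewrite -[X in _ --> X]mul1r; apply: cvgM; last exact: cvg_sNn.
  rewrite -[X in _ --> X](normr1 R) -[X in `|X|]invr1.
  by apply: cvg_norm; apply: cvgV; [exact: oner_neq0|exact: cvg_Gamma_1B].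
have cvE : (`|(Gamma (1 - s))^-1| * (s * Nn s))%:E @[s --> 0^'+] --> (2 * n)%:E.
  by apply: cvg_EFin; [exact: nearW|exact: cv].
(* The norm is identified only for [0 < s <= sigma / 2], where the integral is known to exist, so
   the two functions agree near 0 and not everywhere. *)
apply: cvg_trans cvE; apply: near_eq_cvg; near=> s.
have s0 : 0 < s by near: s; exact: nbhs_right_gt.
have ss : s <= sigma / 2.
  by near: s; apply: nbhs_right_le; rewrite divr_gt0//; case/andP: sigma01.
rewrite (Lnorm1_L1_integral leb mu I (F s) mI (mF s) (FL s) (iF s s0 ss)).
rewrite Lnorm1 /=.
under eq_integral do rewrite normrM EFinM.
rewrite ge0_integralZl_EFin//; last first.
  by apply/measurable_EFinP; apply: measurableT_comp => //; exact: mG.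
transitivity ((`|- (s / Gamma (1 - s))|)%:E * (Nn s)%:E)%E; last by congr (_ * _)%E; rewrite -NnE.
by rewrite -EFinM normrN normrM (gtr0_norm s0); congr EFin; ring.
Unshelve. all: by end_near.
Qed.

End bounded_markov_kernel.

Theorem proposition5p2 (R : realType) (N : nat) (Q B : 'M[R]_N)
    (f : 'R[R]^N -> R) :
  (1 <= N)%N ->
  psdmx Q ->
  (forall t : R, 0 < t -> Kmx Q B t \in unitmx) ->
  \tr B = 0 ->
  (\bigcup_(s in `]0%R, 1%R[) besov Q B s) f ->
  {ae lebesgue_tuple R N, forall X, 0 <= f X} ->
  ('N[lebesgue_tuple R N]_1 [EFin \o frac_power Q B s f])%E @[s --> 0^'+]
    --> (2 * 'N[lebesgue_tuple R N]_1 [EFin \o f])%E.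
Proof.
move=> N1 psdQ unitK trB [sigma /= sigma01 [fL fB]] f0.
move: sigma01; rewrite in_itv/= => sigma01.
have frac_powerE s : frac_power Q B s f = fun X => - (s / Gamma (1 - s)) *
    L1_integral lebesgue_measure (lebesgue_tuple R N) `]0, +oo[ (fun t Y => (t `^ (1 + s))^-1 *
      (averaging (lebesgue_tuple R N) (kernel_p Q B) f t Y - f Y)) X by [].
under eq_fun do rewrite frac_powerE.
apply: (cvg_Lnorm1_L1_integral _ _ (kernel_sup Q B)) sigma01 fB => //.
- exact: measurable_kernel_p.
- exact: kernel_p_ge0.
- exact: integral_kernel_p_right.
- exact: integral_kernel_p_left.
- exact: kernel_p_le.
- by move=> e; exact: kernel_sup_small.
Qed.
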